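(* Let $p$ be an odd prime, let $H,N$ be integers with $0\le H<H+N<p$, and let $\ell\ge r\ge1$ be fixed integers. Let $I_\ell(H,N)$ denote the number of solutions of $$\prod_{i=1}^{\ell}n_i!\equiv\prod_{i=\ell+1}^{2\ell}n_i!\pmod p,\qquad H+1\le n_1,\dots,n_{2\ell}\le H+N.$$ Then $$I_\ell(H,N)=\frac{N^{2\ell}}{p-1}+O\!\left(N^{3\ell/2+r/2-1+2^{-r}}p^{(\ell-r)/4}(\log p)^{(\ell-r)/2}\right).$$
   Context: The implied constant may depend on $\ell$ and $r$ but not on $p,H,N$. *)

(* Defs.v *)
From HB Require Import structures.
From mathcomp Require Import all_boot all_order all_algebra.
From mathcomp Require Import all_reals all_analysis.

Set Implicit Arguments.
Unset Strict Implicit.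
Unset Printing Implicit Defensive.

Import Order.TTheory GRing.Theory Num.Theory.

(* n_1, ..., n_{2l} are indexed from 0: n_{i+1} is [n i] for i : 'I_(2 * l).
   The codomain 'I_(H + N).+1 is the range 0, ..., H + N, which contains
   every admissible value. *)
Definition factorial_solutions (l p H N : nat) :
    {set {ffun 'I_(2 * l) -> 'I_(H + N).+1}} :=
  [set n : {ffun 'I_(2 * l) -> 'I_(H + N).+1} |
    [forall i, (H + 1 <= n i <= H + N)%N] &&
    (\prod_(i < 2 * l | i < l) (n i)`! ==
     \prod_(i < 2 * l | l <= i) (n i)`! %[mod p])%N].

Definition I_count (l p H N : nat) : nat := #|factorial_solutions l p H N|.

(* Main.v *)
Require Import Defs.
From HB Require Import structures.
From mathcomp Require Import all_boot all_order all_algebra.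
From mathcomp Require Import all_fingroup all_solvable all_field.
From mathcomp Require Import all_reals all_analysis.
From mathcomp Require Import zify ring lra.

(** Orthogonality of the multiplicative characters chi of F_p gives
    I_l = (p-1)^-1 sum_chi |S(chi)|^(2l) with S(chi) = sum_n chi(n!), and the
    trivial character contributes the main term.  The other characters contribute
    at most max |S(chi)|^(2(l-r)) I_r.

    I_r is bounded by induction: cut the interval into pieces of length K; for a
    fixed difference k < K and a fixed value, n!/(n+k)! takes that value for at
    most k integers n.

    |S(chi)|^2 is bounded by comparing S(chi) with its translates by k < K, where
    (n+k)! = n! (n+1)...(n+k).  Cauchy-Schwarz reduces the question to sums of
    chi((n+m+1)...(n+k)) over an interval.  As the quantity to be bounded is a sum
    of squares, the interval may be replaced by differences of two intervals, whose
    Fourier transform is nonnegative; this needs only the bound d sqrt p for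
    complete sums of chi(f(x)) psi(x), where f has d distinct roots in F_p.

    That Weil bound is proved by Stepanov's method.  The L-function of (chi, psi)
    is a polynomial of degree at most d, so the sums over F_{p^k} are power sums
    -sum_i w_i^k, and |w_i| <= sqrt p follows from an estimate O(p^(k/2)) for even
    k with any constant.  This estimate comes from counting the x in F_{p^k} with
    prescribed norm of f(x) and prescribed trace; the substitution
    x = z^p - z + c removes the trace condition. *)

Set Implicit Arguments.
Unset Strict Implicit.
Unset Printing Implicit Defensive.

Import Order.TTheory GRing.Theory Num.Theory.
Local Open Scope ring_scope.

(** * Stepanov's method *)

(** Dimension count that will produce the auxiliary polynomial. Matrices appear because the unknowns
    are the coefficients of several polynomials, and so are the conditions. *)
Lemma nontrivial_kernel (K : fieldType) (a b c d : nat)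
    (f : 'M[K]_(a, b) -> 'M[K]_(c, d)) :
  linear f -> (c * d < a * b)%N -> exists2 A, A != 0 & f A = 0.
Proof.
move=> linf lt_cd.
pose fL := GRing.isLinear.Build K _ _ _ f linf.
pose g : {linear 'M[K]_(a, b) -> 'M[K]_(c, d)} := HB.pack f fL.
have /rowV0Pn [v /sub_kermxP vg v_neq0] : kermx (lin_mx g) != 0.
  rewrite kermx_eq0 /row_free neq_ltn.
  by rewrite (leq_ltn_trans (rank_leq_col _) lt_cd).
exists (vec_mx v); first by rewrite -(inj_eq (can_inj vec_mxK)) linear0 in v_neq0 *.
have := mul_vec_lin g (vec_mx v); rewrite vec_mxK vg => /esym/eqP.
by rewrite mxvec_eq0 => /eqP.
Qed.

Lemma size_mul_leqS (R : nzSemiRingType) (f g : {poly R}) m n :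
  (size f <= m.+1)%N -> (size g <= n.+1)%N -> (size (f * g)%R <= (m + n).+1)%N.
Proof. by move=> hf hg; apply: leq_trans (size_polyMleq _ _) _; lia. Qed.

Lemma size_exp_leqS (R : nzSemiRingType) (f : {poly R}) m n :
  (size f <= m.+1)%N -> (size (f ^+ n)%R <= (n * m).+1)%N.
Proof.
move=> hf; elim: n => [|n IHn]; first by rewrite expr0 size_poly1.
by rewrite exprS mulSn; apply: size_mul_leqS.
Qed.

Lemma size_nderivn_leq (R : nzRingType) (f : {poly R}) t : (size f^`N(t) <= size f)%N.
Proof.
apply/leq_sizeP => i hi; rewrite coef_nderivn nth_default ?mul0rn //.
by rewrite (leq_trans hi) // leq_addl.
Qed.

Lemma poly_taylor (R : comNzRingType) (f : {poly R}) x :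
  f = \sum_(i < size f) (f^`N(i).[x])%:P * ('X - x%:P) ^+ i.
Proof.
rewrite -[LHS]comp_polyXr /comp_poly -['X](addrNK x%:P) [_ + x%:P]addrC.
rewrite nderiv_taylor; last exact: mulrC.
rewrite size_map_polyC addrAC addrC addrA addrK; apply: eq_bigr => i _.
by rewrite nderivn_map horner_map.
Qed.

(** Divided derivatives are the Taylor coefficients at [x], so they detect the order of vanishing in
    any characteristic; ordinary derivatives fail in characteristic p once [M] exceeds p. *)
Lemma dvdp_XsubC_exp_nderivn (K : fieldType) (f : {poly K}) x M :
  (forall t, (t < M)%N -> f^`N(t).[x] = 0) -> ('X - x%:P) ^+ M %| f.
Proof.
move=> f0; rewrite [X in _ %| X](poly_taylor f x).
apply: (big_ind (fun q => _ %| q)) => [|g h|i _]; [exact: dvdp0|exact: dvdp_add|].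
have [/f0->|leMi] := ltnP i M; first by rewrite mul0r dvdp0.
by rewrite dvdp_mull // dvdp_exp2l.
Qed.

(* The orders of vanishing at [b] separate the terms of the sum. *)
Lemma sum_XsubC_order_indep (K : fieldType) (b : K) (e m : nat) (k G : nat -> {poly K})
    (E : nat -> nat) :
  (forall n, ~~ root (G n) b) -> (forall n, E n + e <= E n.+1)%N ->
  (forall n, (n < m)%N -> size (k n) <= e)%N ->
  \sum_(n < m) k n * (G n * ('X - b%:P) ^+ E n) = 0 ->
  forall n, (n < m)%N -> k n = 0.
Proof.
move=> Gb hE hk sum0; elim/ltn_ind => n IHn lt_nm.
have leE n1 n2 : (n1 < n2)%N -> (E n1 + e <= E n2)%N.
  elim: n2 => // n2 IH; rewrite ltnS leq_eqVlt => /predU1P[->//|/IH].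
  by move/leq_trans; apply; apply: leq_trans (hE _); rewrite leq_addr.
have: ('X - b%:P) ^+ (E n + e) %| k n * (G n * ('X - b%:P) ^+ E n).
  have:= sum0; rewrite (bigD1 (Ordinal lt_nm)) //= => /eqP.
  rewrite addr_eq0 => /eqP->; rewrite dvdpNr.
  apply: (big_ind (fun q => _ %| q)) => [|g h|i]; [exact: dvdp0|exact: dvdp_add|].
  rewrite -val_eqE /= neq_ltn => /orP[lt_in|lt_ni].
    by rewrite IHn // mul0r dvdp0.
  by rewrite mulrA dvdp_mull // dvdp_exp2l // leE.
rewrite mulrA addnC exprD dvdp_mul2r ?expf_neq0 ?polyXsubC_eq0 //.
rewrite Gauss_dvdpl; last first.
  by rewrite coprimep_expl // coprimep_sym coprimep_XsubC.
move=> dvd_k; apply/eqP; apply: contraTT (hk n lt_nm) => k_neq0.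
rewrite -ltnNge; have := dvdp_leq k_neq0 dvd_k.
by rewrite size_exp_XsubC.
Qed.

Section Stepanov.
Variables (K : fieldType) (p s : nat).
Hypotheses (p_char : p \in [pchar K]) (p_gt2 : (2 < p)%N) (s_gt0 : (0 < s)%N).

(** [Q] plays the size of the finite field and [M] its square root; [e = (Q - 1) / (p - 1)] is the
    exponent of the norm down to the prime field. *)
Let M := (p ^ s)%N.
Let Q := (M * M)%N.
Let b := p.-1.
Let e0 := (\sum_(i < s) p ^ i)%N.
Let e := (e0 * M.+1)%N.

Let e0E : (b * e0 = M.-1)%N.
Proof. by rewrite /b /e0 -predn_exp. Qed.

Let M_gt2 : (2 < M)%N.
Proof. by rewrite (leq_trans p_gt2) // -{1}(expn1 p) leq_pexp2l //; lia. Qed.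

Let pnatM : [pchar {poly K}].-nat M.
Proof.
rewrite pnatX; apply/orP; left.
by rewrite (eq_pnat _ (pchar_poly K)) pnatE ?(pcharf_prime p_char).
Qed.

Let exprB_M (f g : {poly K}) : (f - g) ^+ M = f ^+ M - g ^+ M.
Proof.
apply/eqP; rewrite -[_ == _](inj_eq (addIr (g ^+ M))) subrK.
by rewrite -exprDn_pchar ?subrK.
Qed.

Let exprB_Q (f g : {poly K}) : (f - g) ^+ Q = f ^+ Q - g ^+ Q.
Proof. by rewrite !exprM !exprB_M. Qed.

Let dvdp_M (f : {poly K}) x : ('X - x%:P) ^+ M %| f ^+ M - ((f.[x]) ^+ M)%:P.
Proof.
rewrite rmorphXn /= -exprB_M; apply: dvdp_exp2r.
by rewrite dvdp_XsubCl rootE !hornerE subrr.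
Qed.

Variables (F F1 : {poly K}) (beta u : K) (D : nat).
Hypotheses (sizeF : (size F <= D.+1)%N) (F_eq : F = ('X - beta%:P) * F1).
Hypotheses (F1_beta : ~~ root F1 beta) (u_neq0 : u != 0).

(** Chosen for [dim_lt]: there are [J * (Q - 1)] unknowns. The part [e0] pays for the [M * e]
    conditions up to lower order, the rest for [M * M * D] and the remainder. *)
Let J := (e0 + 2 * D + 4)%N.
Let m := (b * J)%N.

(** The index [n] encodes the pair [i = n %% b], [j = n %/ b]. At the points to be counted, [F ^ e]
    takes the value [u] and the [Q]-th power is the identity. *)
Let w n : {poly K} := F ^+ ((n %% b) * e) * ('X - beta%:P) ^+ ((n %/ b) * Q).

(** At a point [x] to be counted, this is the [t]-th divided derivative of the [n]-th term reduced
    modulo [(X - x) ^ M], cleared of denominators by [F(x) ^ ((b - 1) * e0)]. Being a polynomial in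
    [x], it lets one set of equations handle all points. *)
Let cnd n t (g : {poly K}) : {poly K} :=
  (u ^+ (n %% b))%:P * F ^+ ((b.-1 - n %% b) * e0)
  * ('X - (beta ^+ Q)%:P) ^+ (n %/ b) * (g * F ^+ ((n %% b) * e0))^`N(t).

Let B := (e + M * D + J)%N.

Let phi (A : 'M[K]_(m, e)) : 'M[K]_(M, B) :=
  \matrix_(t < M) poly_rV (\sum_(n < m) cnd n t (rVpoly (row n A))).

Let phi_linear : linear phi.
Proof.
move=> a A1 A2; apply/row_matrixP => t; rewrite linearP /= !rowK -linearP /=.
congr (poly_rV _); rewrite scaler_sumr -big_split /=; apply: eq_bigr => n _.
rewrite /cnd !linearP /= mulrDl -scalerAl linearP /= mulrDr; congr (_ + _).
by rewrite -scalerAr.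
Qed.

Let b_gt1 : (1 < b)%N. Proof. by rewrite /b; lia. Qed.

Let e0_gt0 : (0 < e0)%N.
Proof. by move: e0E M_gt2; case: (e0) => //; rewrite muln0; lia. Qed.

Let e_gt0 : (0 < e)%N. Proof. by rewrite muln_gt0 e0_gt0. Qed.

Let be : (b * e = Q.-1)%N.
Proof. by rewrite /e mulnA e0E /Q; move: M_gt2; nia. Qed.

Let dim_lt : (M * B < m * e)%N.
Proof.
rewrite /m /B mulnAC be /Q /e /J.
have h2 : (2 * e0 <= M.-1)%N by rewrite -e0E leq_mul2r b_gt1 orbT.
move: M_gt2 h2; clear; move: (M) (e0) => x y h1 h2; nia.
Qed.

Let divn_lt n : (n < m)%N -> (n %/ b < J)%N.
Proof. by move=> h; rewrite ltn_divLR; [rewrite mulnC|lia]. Qed.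

Let modn_lt n : (n %% b < b)%N. Proof. by rewrite ltn_mod; lia. Qed.

Let size_cnd n t (g : {poly K}) : (n < m)%N -> (size g <= e)%N -> (size (cnd n t g) <= B)%N.
Proof.
move=> /divn_lt hn hg; have := modn_lt n; rewrite /cnd.
move: (n %% b)%N (n %/ b)%N hn => i j hj hi.
have h1 : (size (g * F ^+ (i * e0))%R <= (e.-1 + i * e0 * D).+1)%N.
  by apply: size_mul_leqS; [rewrite prednK | apply: size_exp_leqS].
have h2 := leq_trans (size_nderivn_leq _ t) h1.
have h3 : (size ('X - (beta ^+ Q)%:P)%R <= 2)%N by rewrite size_XsubC.
have h4 := size_mul_leqS (size_mul_leqS (size_mul_leqS (size_polyC_leq1 (u ^+ i))
  (size_exp_leqS ((b.-1 - i) * e0) sizeF)) (size_exp_leqS j h3)) h2.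
apply: leq_trans h4 _; rewrite /B.
have : ((b.-1 - i) * e0 * D + i * e0 * D <= M * D)%N.
  rewrite -mulnDl leq_mul2r -mulnDl; apply/orP; right.
  by apply: leq_trans (_ : b * e0 <= _)%N; [rewrite leq_mul2r; lia | rewrite e0E; lia].
by move: e_gt0 hj; lia.
Qed.

Let aux (A : 'M[K]_(m, e)) : {poly K} := \sum_(n < m) rVpoly (row n A) * w n.

(** At the simple root [beta] of [F], [w n] has order [i * e + j * Q]. These orders grow by at least
    [e], which exceeds the degree of the coefficients; when [i] wraps around, the step is
    [Q - (b - 1) * e = e + 1]. *)
Let aux_neq0 (A : 'M[K]_(m, e)) : A != 0 -> aux A != 0.
Proof.
apply: contraNneq => aux0; apply/eqP/row_matrixP => n; rewrite row0.
pose k i := if insub i is Some n then rVpoly (row n A) else 0 : {poly K}.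
have kE (i : 'I_m) : k i = rVpoly (row i A).
  by rewrite /k; case: insubP => [j _ /val_inj->//|]; rewrite ltn_ord.
apply: (can_inj (@rVpolyK _ _)); rewrite -kE linear0.
apply: (@sum_XsubC_order_indep _ beta e m k (fun i => F1 ^+ ((i %% b) * e))
   (fun i => (i %% b) * e + (i %/ b) * Q)%N) => //.
- by move=> i; rewrite rootE horner_exp expf_eq0 negb_and -rootE F1_beta orbT.
- move=> i; have hi := modn_lt i; rewrite divnS ?modnS; last by lia.
  case: ifP => _ /=; last by rewrite mulSn; lia.
  rewrite mul0n mulSn !add0n; apply: leq_trans (_ : b * e + i %/ b * Q <= _)%N.
    by rewrite addnAC leq_add2r addnC -mulSn leq_mul2r hi orbT.
  by rewrite leq_add2r be leq_pred.
- by move=> i hi; rewrite /k; case: insubP => [j _ _|_]; rewrite ?size_poly ?size_poly0.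
rewrite -[RHS]aux0; apply: eq_bigr => i _; rewrite kE /w F_eq exprMn exprD.
by congr (_ * _); rewrite mulrCA -!mulrA mulrC -mulrA.
Qed.

Let size_aux (A : 'M[K]_(m, e)) : (size (aux A) <= e + Q * D + J.-1 * Q)%N.
Proof.
apply: leq_trans (size_sum _ _ _) _; apply/bigmax_leqP => n _.
have /divn_lt hn := ltn_ord n; have hi := modn_lt n; rewrite /w.
have h1 : (size (rVpoly (row n A)) <= e.-1.+1)%N by rewrite prednK // size_poly.
have h3 : (size ('X - beta%:P)%R <= 2)%N by rewrite size_XsubC.
have h4 := size_mul_leqS h1 (size_mul_leqS (size_exp_leqS ((n %% b) * e) sizeF)
  (size_exp_leqS ((n %/ b) * Q) h3)).
apply: leq_trans h4 _.
have : ((n %% b) * e * D <= Q * D)%N.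
  rewrite leq_mul2r; apply/orP; right; apply: leq_trans (_ : b * e <= _)%N.
    by rewrite leq_mul2r (ltnW hi) orbT.
  by rewrite be leq_pred.
have : (n %/ b * Q <= J.-1 * Q)%N by rewrite leq_mul2r; apply/orP; right; lia.
by move: e_gt0; lia.
Qed.

(** Modulo [(X - x) ^ M] every [M]-th power is constant: [F ^ (i * e)] becomes [F ^ (i * e0)] times
    [u ^ i / F(x) ^ (i * e0)], and [(X - beta) ^ (j * Q)] becomes [(x - beta ^ Q) ^ j]. What remains
    is [W], whose divided derivatives at [x] vanish because [phi A = 0]. *)
Let dvdp_aux (A : 'M[K]_(m, e)) x : phi A = 0 -> x ^+ Q = x -> F.[x] ^+ e = u ->
  ('X - x%:P) ^+ M %| aux A.
Proof.
move=> phi0 xQ Fx.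
have Fx_neq0 : F.[x] != 0.
  by apply: contraNneq u_neq0 => Fx0; rewrite -Fx Fx0 expr0n gtn_eqF.
pose c n := u ^+ (n %% b) / F.[x] ^+ ((n %% b) * e0) * (x - beta ^+ Q) ^+ (n %/ b).
pose W := \sum_(n < m) c n *: (rVpoly (row n A) * F ^+ ((n %% b) * e0)).
have dvdW : ('X - x%:P) ^+ M %| W.
  apply: dvdp_XsubC_exp_nderivn => t lt_tM.
  have : (\sum_(n < m) cnd n t (rVpoly (row n A))).[x] = 0.
    have /(congr1 (row (Ordinal lt_tM))) := phi0; rewrite rowK row0 => h.
    have {h} := congr1 rVpoly h; rewrite linear0 poly_rV_K => [->|]; first by rewrite horner0.
    apply: leq_trans (size_sum _ _ _) _; apply/bigmax_leqP => n _.
    by apply: size_cnd; rewrite ?size_poly.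
  rewrite /W linear_sum /= !horner_sum => h.
  apply: (mulfI (expf_neq0 (b.-1 * e0) Fx_neq0)); rewrite mulr0 -[RHS]h mulr_sumr.
  apply: eq_bigr => n _; rewrite linearZ /= hornerZ /cnd !hornerM !horner_exp hornerC hornerXsubC.
  rewrite !mulrA; congr (_ * _); rewrite /c.
  have -> : F.[x] ^+ (b.-1 * e0) = F.[x] ^+ ((b.-1 - n %% b) * e0) * F.[x] ^+ ((n %% b) * e0).
    by rewrite -exprD -mulnDl subnK //; have := modn_lt n; lia.
  have := expf_neq0 (n %% b * e0) Fx_neq0.
  by move: (F.[x] ^+ (n %% b * e0)) => y y_neq0; field.
rewrite -(subrK W (aux A)) dvdp_add // /aux /W -sumrB.
apply: (big_ind (fun q => _ %| q)) => [|g h|n _]; [exact: dvdp0|exact: dvdp_add|].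
rewrite /w /c -mul_polyC polyCM.
set k := rVpoly _; set i := (n %% b)%N; set j := (n %/ b)%N.
have -> : (u ^+ i / F.[x] ^+ (i * e0)) = (F.[x] ^+ (i * e0)) ^+ M.
  apply: (mulIf (expf_neq0 (i * e0) Fx_neq0)); rewrite divfK ?expf_neq0 //.
  by rewrite -exprSr -!exprM -Fx -exprM; congr (_ ^+ _); rewrite /e; lia.
have -> : F ^+ (i * e) = F ^+ (i * e0) * (F ^+ (i * e0)) ^+ M.
  by rewrite -exprS -exprM; congr (_ ^+ _); rewrite /e; lia.
set f := F ^+ (i * e0); set y := F.[x] ^+ (i * e0).
have dvd1 : ('X - x%:P) ^+ M %| f ^+ M - (y ^+ M)%:P.
  by have := dvdp_M f x; rewrite horner_exp.
have dvd2 : ('X - x%:P) ^+ M %| ('X - beta%:P) ^+ (j * Q) - ((x - beta ^+ Q) ^+ j)%:P.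
  rewrite mulnC exprM [X in _ %| X](_ : _ = (('X - beta%:P) ^+ Q) ^+ j - ((x - beta ^+ Q)%:P) ^+ j); last first.
    by rewrite rmorphXn.
  rewrite subrXX dvdp_mulr // exprB_Q -[beta%:P ^+ Q]rmorphXn /= polyCB opprB addrA subrK.
  have := dvdp_M ('X ^+ M) x; rewrite -exprM hornerXn.
  by rewrite -exprM xQ.
rewrite [X in _ %| X](_ : _ = k * f * ((f ^+ M - (y ^+ M)%:P) * ('X - beta%:P) ^+ (j * Q)
   + (y ^+ M)%:P * (('X - beta%:P) ^+ (j * Q) - ((x - beta ^+ Q) ^+ j)%:P))); last by ring.
by apply/dvdp_mull/dvdp_add; [apply: dvdp_mulr|apply: dvdp_mull].
Qed.

(** The nonzero [aux A] vanishes to order [M] on [Z], so [size Z * M] is below its size. After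
    multiplication by [b], the part [e0] of [J] gives the main term, since [b * e0 = M - 1];
    dividing by [M] leaves an error of order [M]. *)
Theorem stepanov_bound (Z : seq K) : uniq Z ->
  (forall x, x \in Z -> x ^+ (p ^ s.*2) = x /\ F.[x] ^+ (\sum_(i < s.*2) p ^ i) = u) ->
  (p.-1 * size Z <= p ^ s.*2 + p.-1 * (3 * D + 4) * p ^ s)%N.
Proof.
have -> : (p ^ s.*2 = Q)%N by rewrite -addnn expnD.
have -> : (\sum_(i < s.*2) p ^ i = e)%N.
  rewrite -addnn big_split_ord /= /e mulnS; congr (_ + _)%N.
  by rewrite /e0 big_distrl /=; apply: eq_bigr => i _; rewrite expnD mulnC.
move=> uniqZ hZ; have [A A_neq0 phiA] := nontrivial_kernel phi_linear dim_lt.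
have auxA := aux_neq0 A_neq0.
have dvdZ : \prod_(x <- Z) ('X - x%:P) ^+ M %| aux A.
  elim: Z uniqZ hZ => [|x Z IHZ] /=; first by rewrite big_nil dvd1p.
  move=> /andP[xZ uniqZ] hZ; rewrite big_cons Gauss_dvdp; last first.
    rewrite big_seq; apply: (big_ind (fun q => coprimep _ q)) => [|q1 q2 h1 h2|y yZ].
    - exact: coprimep1.
    - by rewrite coprimepMr h1.
    apply/coprimep_expl/coprimep_expr; rewrite coprimep_XsubC root_XsubC.
    by apply: contraNneq xZ => <-.
  have [x1 x2] := hZ x (mem_head _ _); rewrite dvdp_aux //=.
  by apply: IHZ => // y yZ; apply: hZ; rewrite inE yZ orbT.
have := dvdp_leq auxA dvdZ.
have -> : size (\prod_(x <- Z) ('X - x%:P) ^+ M) = (size Z * M).+1.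
  rewrite prodrXl -[LHS]prednK; first by rewrite size_exp size_prod_XsubC.
  by rewrite size_poly_gt0 expf_neq0 // monic_neq0 // monic_prod_XsubC.
move/leq_trans/(_ (size_aux A)).
have : (size Z * M < e + Q * D + J.-1 * Q)%N -> (p.-1 * size Z <= Q + p.-1 * (3 * D + 4) * M)%N.
  rewrite -/b => h; rewrite -(leq_pmul2r (_ : 0 < M)%N); last by lia.
  have h' : (b * (size Z * M) <= b * (e + Q * D + J.-1 * Q))%N by rewrite leq_mul2l (ltnW h) orbT.
  rewrite !mulnDr be in h'; rewrite -mulnA; apply: leq_trans h' _.
  have -> : (J.-1 = e0 + (2 * D + 3))%N by rewrite /J; lia.
  have -> : (b * ((e0 + (2 * D + 3)) * Q) = M.-1 * Q + b * (2 * D + 3) * Q)%N.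
    by rewrite mulnDl mulnDr !(mulnA b _ Q) e0E.
  have -> : ((Q + b * (3 * D + 4) * M) * M = Q * M + b * (3 * D + 4) * Q)%N.
    by rewrite mulnDl -(mulnA _ M M).
  have : (M.-1 * Q + Q = Q * M)%N by rewrite -mulSnr prednK 1?mulnC //; lia.
  have : (Q * 1 <= b * Q)%N by rewrite mulnC leq_mul2r; lia.
  move: (Q) (M.-1 * Q)%N (Q * M)%N => y z t; move: (b) => b'; clear; nia.
by apply; lia.
Qed.

End Stepanov.

(** * Points over finite fields and characteristic polynomials *)

Lemma sum_count_mem_undup (T : eqType) (s : seq T) :
  (\sum_(x <- undup s) count_mem x s = size s)%N.
Proof.
rewrite -sum1_size -(big_undup_iterop_count _ s); apply: eq_bigr => x _.
by rewrite Monoid.iteropE iter_addn_0 mul1n.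
Qed.

Lemma mup_prod_XsubC (K : fieldType) (x : K) (s : seq K) :
  mup x (\prod_(z <- s) ('X - z%:P)) = count_mem x s.
Proof.
elim: s => [|z s IHs] /=; first by rewrite big_nil mupNroot // root1.
rewrite big_cons mupM ?polyXsubC_eq0 ?monic_neq0 ?monic_prod_XsubC // IHs.
by rewrite -[_ - _]expr1 mup_XsubCX eq_sym; case: eqP.
Qed.

Section FrobeniusPoints.
Variables (p : nat) (p_pr : prime p) (W : closedFieldType) (iota : {rmorphism 'F_p -> W}).

Lemma pchar_closure : p \in [pchar W].
Proof. by rewrite (fmorph_pchar iota) pchar_Fp. Qed.

Lemma pow_prime_gt1 k : (0 < k)%N -> (1 < p ^ k)%N.
Proof.
move=> k_gt0; apply: leq_trans (prime_gt1 p_pr) _.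
by rewrite -{1}(expn1 p) leq_pexp2l ?(prime_gt0 p_pr).
Qed.

Lemma expr_Fp (y : 'F_p) : y ^+ p = y.
Proof. by have := expf_card y; rewrite card_Fp. Qed.

Lemma exprD_pow k (x y : W) : (x + y) ^+ (p ^ k) = x ^+ (p ^ k) + y ^+ (p ^ k).
Proof.
apply: exprDn_pchar; rewrite pnatX; apply/orP; left.
by rewrite pnatE // pchar_closure.
Qed.

Lemma exprB_pow k (x y : W) : (x - y) ^+ (p ^ k) = x ^+ (p ^ k) - y ^+ (p ^ k).
Proof. by apply/eqP; rewrite eq_sym subr_eq -exprD_pow subrK. Qed.

Lemma expr_pow_inj k : injective (fun x : W => x ^+ (p ^ k)).
Proof.
move=> x y /eqP; rewrite -subr_eq0 -exprB_pow expf_eq0 => /andP[_].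
by rewrite subr_eq0 => /eqP.
Qed.

(** The subfield with [p ^ k] elements. As a list inside one closed field, it is available for all
    [k] at once without constructing extensions. *)
Definition frob_points k : seq W :=
  sval (closed_field_poly_normal ('X^(p ^ k) - 'X : {poly W})).

Lemma frob_points_spec k : (0 < k)%N ->
  'X^(p ^ k) - 'X = \prod_(z <- frob_points k) ('X - z%:P).
Proof.
move=> k_gt0; rewrite /frob_points; case: closed_field_poly_normal => r /= {1}->.
rewrite lead_coefDl ?lead_coefXn ?scale1r //.
rewrite size_polyN size_polyX size_polyXn ltnS.
exact: pow_prime_gt1.
Qed.

Lemma mem_frob_points k x : (0 < k)%N -> (x \in frob_points k) = (x ^+ (p ^ k) == x).
Proof.
move=> k_gt0; rewrite -root_prod_XsubC -frob_points_spec //.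
by rewrite rootE !hornerE subr_eq0.
Qed.

Lemma size_frob_points k : (0 < k)%N -> size (frob_points k) = (p ^ k)%N.
Proof.
move=> k_gt0; apply/eqP; rewrite -eqSS -(size_prod_XsubC _ id) -frob_points_spec //.
rewrite size_polyDl ?size_polyXn // size_polyN size_polyX ltnS.
exact: pow_prime_gt1.
Qed.

Lemma uniq_frob_points k : (0 < k)%N -> uniq (frob_points k).
Proof.
move=> k_gt0; rewrite -separable_prod_XsubC -frob_points_spec // unlock.
rewrite derivB derivXn derivX.
have -> : 'X^((p ^ k).-1) *+ (p ^ k)%N = 0 :> {poly W}.
  have pP : p \in [pchar {poly W}] by rewrite pchar_poly pchar_closure.
  by rewrite -(prednK k_gt0) expnS mulrnA (mulrn_pchar pP) mul0rn.
have -> : 0 - 1 = (-1) *: 1 :> {poly W} by rewrite scaleN1r sub0r.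
by rewrite coprimepZr ?oppr_eq0 ?oner_eq0 // coprimep1.
Qed.

Lemma frob_fixedP x : x ^+ p = x -> exists y, iota y = x.
Proof.
move=> xp; have [_ /(_ x)] : (size (map iota (enum 'F_p)) = size (frob_points 1)) *
   (map iota (enum 'F_p) =i frob_points 1).
  apply: uniq_min_size.
  - by rewrite map_inj_uniq ?enum_uniq //; apply: fmorph_inj.
  - move=> _ /mapP[y _ ->]; rewrite mem_frob_points // expn1 -rmorphXn.
    by rewrite expr_Fp.
  by rewrite size_frob_points // size_map -cardE card_Fp // expn1.
rewrite mem_frob_points // expn1 xp eqxx => /mapP[y _ ->].
by exists y.
Qed.


(** A left inverse of [iota]; the value 0 outside the prime field is arbitrary. *)
Definition frob_desc (x : W) : 'F_p := odflt 0 [pick y | iota y == x].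

Lemma iota_desc x : x ^+ p = x -> iota (frob_desc x) = x.
Proof.
move=> /frob_fixedP[y yx]; rewrite /frob_desc; case: pickP => [z /eqP//|/(_ y)].
by rewrite yx eqxx.
Qed.

Lemma desc_iota : cancel iota frob_desc.
Proof.
move=> y; rewrite /frob_desc; case: pickP => [z /eqP/fmorph_inj//|/(_ y)].
by rewrite eqxx.
Qed.

Lemma frob_desc0 : frob_desc 0 = 0.
Proof. by rewrite -{1}(rmorph0 iota) desc_iota. Qed.

(* The characteristic polynomial of [x] over the prime field, for [x] in the
   field with [p ^ k] elements. *)
Definition frob_cpoly k (x : W) : {poly W} := \prod_(i < k) ('X - (x ^+ (p ^ i))%:P).
Definition frob_cpolyF k (x : W) : {poly 'F_p} := map_poly frob_desc (frob_cpoly k x).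

Lemma monic_frob_cpoly k x : frob_cpoly k x \is monic.
Proof. exact: monic_prod_XsubC. Qed.

Lemma size_frob_cpoly k x : size (frob_cpoly k x) = k.+1.
Proof. by rewrite /frob_cpoly -big_enum size_prod_XsubC size_enum_ord. Qed.

Lemma frob_cpolyD k m x : x ^+ (p ^ m) = x ->
  frob_cpoly (m + k) x = frob_cpoly m x * frob_cpoly k x.
Proof.
move=> xm; rewrite /frob_cpoly big_split_ord; congr (_ * _); apply: eq_bigr => i _ /=.
by rewrite expnD exprM xm.
Qed.

(** Frobenius permutes the linear factors cyclically, hence fixes the coefficients, which therefore
    come from the prime field. *)
Lemma map_frob_cpolyF k x : x ^+ (p ^ k) = x ->
  map_poly iota (frob_cpolyF k x) = frob_cpoly k x.
Proof.
move=> xk; apply/polyP => i; rewrite coef_map /frob_cpolyF coef_map_id0 ?frob_desc0 //=.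
rewrite iota_desc //.
have frobE : map_poly (pFrobenius_aut pchar_closure) (frob_cpoly k x) = frob_cpoly k x.
  rewrite /frob_cpoly rmorph_prod /=.
  under eq_bigr => j _ do rewrite rmorphB /= map_polyX map_polyC /= pFrobenius_autE -exprM -expnSr.
  case: (k) xk => [|n] xn; first by rewrite !big_ord0.
  by rewrite big_ord_recr big_ord_recl /= mulrC expn0 expr1 xn.
by rewrite -[in RHS]frobE coef_map /= pFrobenius_autE.
Qed.

Lemma monic_frob_cpolyF k x : x ^+ (p ^ k) = x -> frob_cpolyF k x \is monic.
Proof. by move=> xk; rewrite -(map_monic iota) map_frob_cpolyF ?monic_frob_cpoly. Qed.

Lemma size_frob_cpolyF k x : x ^+ (p ^ k) = x -> size (frob_cpolyF k x) = k.+1.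
Proof. by move=> xk; rewrite -(size_map_poly iota) map_frob_cpolyF ?size_frob_cpoly. Qed.

Lemma root_frob (h : {poly 'F_p}) x i :
  root (map_poly iota h) x -> root (map_poly iota h) (x ^+ (p ^ i)).
Proof.
move=> hx; elim: i => [|i]; first by rewrite expn0 expr1.
rewrite expnSr exprM; move: (x ^+ _) => y; rewrite !rootE => /eqP hy.
rewrite -[y ^+ p](pFrobenius_autE pchar_closure).
have -> : map_poly iota h = map_poly (pFrobenius_aut pchar_closure) (map_poly iota h).
  rewrite -map_poly_comp; apply: eq_map_poly => z /=.
  by rewrite pFrobenius_autE -rmorphXn expr_Fp.
by rewrite horner_map hy rmorph0.
Qed.

(** The iterates of [x] under Frobenius are roots of [h], so two of the first [size h] coincide, and
    injectivity turns this into a return to [x]. The least period is the degree of [x]. *)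
Lemma frob_period (h : {poly 'F_p}) x : h != 0 -> root (map_poly iota h) x ->
  exists m, [/\ (0 < m)%N, x ^+ (p ^ m) = x &
    forall k, (0 < k < m)%N -> x ^+ (p ^ k) != x].
Proof.
move=> h_neq0 hx.
have: exists m, (0 < m)%N && (x ^+ (p ^ m) == x).
  pose s := [seq x ^+ (p ^ i) | i <- seq.iota 0 (size h)].
  have : ~~ uniq s.
    apply/negP => us; have := @max_poly_roots _ (map_poly iota h) s.
    rewrite map_poly_eq0 size_map_poly h_neq0 => /(_ isT _ us).
    rewrite size_map size_iota ltnn; suff -> : all (root (map_poly iota h)) s by move/(_ isT).
    by apply/allP => _ /mapP[i _ ->]; apply: root_frob.
  move/(uniqPn 0) => [i [j [ij js]]].
  rewrite size_map size_iota in js; rewrite !(nth_map 0%N) ?size_iota ?(ltn_trans ij) //.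
  rewrite !nth_iota ?(ltn_trans ij) // !add0n => E.
  exists (j - i)%N; rewrite subn_gt0 ij /=; apply/eqP/(@expr_pow_inj i).
  by rewrite -exprM -expnD subnK ?(ltnW ij).
move=> ex; case: (ex_minnP ex) => m /andP[m0 /eqP xm] minm; exists m; split => // k /andP[k0 km].
by apply/negP => xk; have := minm k; rewrite k0 xk => /(_ isT); rewrite leqNgt km.
Qed.

(** Let [x] have degree m and minimal polynomial P over the prime field. The index [k] contributes
    only if m divides it, and then the characteristic polynomial is P to the power k/m; so the sum
    counts the powers of P dividing [h]. The induction removes one factor P and shifts [k] by m. *)
Lemma mup_frob_count (h : {poly 'F_p}) x : h \is monic ->
  (\sum_(1 <= k < size h) ((x ^+ (p ^ k) == x) && (frob_cpolyF k x %| h)%R) =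
   mup x (map_poly iota h))%N.
Proof.
have [n] := ubnP (size h); elim: n h => // n IHn h lt_hn h_monic.
have h_neq0 := monic_neq0 h_monic.
have [rx|nrx] := boolP (root (map_poly iota h) x); last first.
  rewrite mupNroot //; apply: big1_seq => k /andP[_]; rewrite mem_index_iota => /andP[k_gt0 _].
  apply/eqP; rewrite eqb0; apply: contra nrx => /andP[/eqP xk].
  rewrite -(dvdp_map iota) map_frob_cpolyF // -dvdp_XsubCl; apply: dvdp_trans.
  by rewrite -(prednK k_gt0) /frob_cpoly big_ord_recl /= expn0 expr1 dvdp_mulr.
have [m [m_gt0 xm minm]] := frob_period h_neq0 rx.
have us : uniq [seq x ^+ (p ^ val i) | i <- enum 'I_m].
  rewrite map_inj_in_uniq ?enum_uniq // => i j _ _.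
  wlog: i j / (i <= j)%N => [W1|le_ij] E.
    by have /orP[/W1|/W1/(_ (esym E))] := leq_total i j; [apply|].
  apply/val_inj/eqP; rewrite eqn_leq le_ij leqNgt; apply/negP => lt_ij.
  have /minm/eqP[] : (0 < j - i < m)%N by rewrite subn_gt0 lt_ij (leq_ltn_trans (leq_subr _ _)).
  by apply: (@expr_pow_inj i); rewrite -exprM -expnD subnK.
have cpE : frob_cpoly m x = \prod_(z <- [seq x ^+ (p ^ val i) | i <- enum 'I_m]) ('X - z%:P).
  by rewrite big_map big_enum.
have /dvdpP[g hE] : frob_cpolyF m x %| h.
  rewrite -(dvdp_map iota) map_frob_cpolyF // cpE.
  apply: uniq_roots_dvdp; last by rewrite uniq_rootsE.
  by apply/allP => _ /mapP[i _ ->]; apply: root_frob.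
have P_monic := monic_frob_cpolyF xm.
have g_monic : g \is monic by rewrite -(monicMr g P_monic) -hE.
have g_neq0 := monic_neq0 g_monic; have P_neq0 := monic_neq0 P_monic.
have sz_h : size h = (m + size g)%N.
  by rewrite hE size_mul // size_frob_cpolyF // addnS addnC.
have sz_g : (0 < size g)%N by rewrite size_poly_gt0.
have lt_gn : (size g < n)%N by move: lt_hn; rewrite sz_h; lia.
rewrite [in RHS]hE rmorphM /= mupM ?map_poly_eq0 // -(IHn g lt_gn g_monic).
rewrite map_frob_cpolyF // cpE mup_prod_XsubC count_uniq_mem //.
have -> : x \in [seq x ^+ (p ^ val i) | i <- enum 'I_m].
  by apply/mapP; exists (Ordinal m_gt0); rewrite ?mem_enum //= expn0 expr1.
rewrite sz_h (big_cat_nat (n := m)) ?leq_addr //= [X in (X + _)%N]big1_seq; last first.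
  move=> k; rewrite mem_index_iota => /andP[_ /minm]; by case: eqP.
rewrite add0n big_ltn; last by rewrite -{1}[m]addn0 ltn_add2l.
rewrite [RHS]addnC; congr (_ + _)%N; first by rewrite xm eqxx hE dvdp_mull.
rewrite -[m.+1]add1n [(m + size g)%N]addnC big_addn addnK.
apply: eq_big_nat => k /andP[k_gt0 _]; rewrite addnC expnD exprM xm.
case: eqP => //= xk; rewrite -(dvdp_map iota) map_frob_cpolyF; last first.
  by rewrite expnD exprM xm.
rewrite frob_cpolyD // hE rmorphM /= map_frob_cpolyF // mulrC dvdp_mul2r; last first.
  by rewrite monic_neq0 ?monic_frob_cpoly.
by rewrite -[in RHS](dvdp_map iota) map_frob_cpolyF.
Qed.

(** The multiplicities of the roots of [h] add up to its degree. This identity replaces the Euler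
    product in the logarithmic derivative of the L-function. *)
Theorem frob_count (h : {poly 'F_p}) : h \is monic ->
  (\sum_(1 <= k < size h) \sum_(x <- frob_points k) (frob_cpolyF k x %| h)%R =
   (size h).-1)%N.
Proof.
move=> h_monic; have [rs hE] := closed_field_poly_normal (map_poly iota h).
rewrite (monicP _) ?map_monic // scale1r in hE.
have sz_rs : size rs = (size h).-1 by rewrite -(size_map_poly iota) hE size_prod_XsubC.
rewrite -sz_rs -(sum_count_mem_undup rs).
under [RHS]eq_bigr => x _ do rewrite -mup_prod_XsubC -hE -mup_frob_count //.
rewrite [RHS]exchange_big /=; apply: eq_big_nat => k /andP[k_gt0 _].
under [RHS]eq_bigr => x _ do rewrite -mulnb mulnbl.
rewrite -[RHS]big_mkcond -[RHS]big_filter /= [LHS](bigID (mem rs)) /=.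
rewrite [X in (_ + X)%N]big1_seq ?addn0 => [|x /andP[xrs]].
  rewrite -[LHS]big_filter; apply: perm_big; apply: uniq_perm.
  - by rewrite filter_uniq // uniq_frob_points.
  - by rewrite filter_uniq // undup_uniq.
  by move=> x; rewrite !mem_filter mem_undup mem_frob_points // andbC.
rewrite mem_frob_points // => /eqP xk; apply/eqP; rewrite eqb0; apply: contra xrs.
rewrite -root_prod_XsubC -hE -(dvdp_map iota) map_frob_cpolyF // -dvdp_XsubCl.
apply: dvdp_trans; rewrite -(prednK k_gt0) /frob_cpoly big_ord_recl /= expn0 expr1.
exact: dvdp_mulr.
Qed.

End FrobeniusPoints.

(** * L-functions and the Weil bound *)

(** [- X G' / G] is the generating series of the power sums. To stay within polynomials the series
    is cut after degree [n] and its tail goes into [H]. *)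
Lemma newton_log_derivative (R : comNzRingType) (s : seq R) (n : nat) :
  let G := \prod_(w <- s) (1 - w *: 'X) in
  exists H : {poly R}, - ('X * G^`()) =
    G * (\sum_(1 <= k < n.+1) (\sum_(w <- s) w ^+ k) *: 'X^k) + 'X^(n.+1) * H.
Proof.
elim: s => [|w s [H IHs]] /=.
  exists 0; rewrite big_nil derivC mulr0 oppr0 mulr0 addr0 big1 ?mulr0 // => k _.
  by rewrite big_nil scale0r.
rewrite big_cons; set G := \prod_(j <- s) _ in IHs *.
exists ((1 - w *: 'X) * H + w ^+ n.+1 *: G).
under eq_bigr => k _ do rewrite big_cons scalerDl.
rewrite big_split /= derivM derivB derivC derivZ derivX sub0r.
have geom : (1 - w *: 'X) * (\sum_(1 <= k < n.+1) w ^+ k *: 'X^k) =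
    w *: 'X - w ^+ n.+1 *: 'X^(n.+1).
  elim: (n) => [|m IHm]; first by rewrite big_nil mulr0 expr1 subrr.
  rewrite big_nat_recr //= mulrDr IHm mulrBl mul1r -scalerAl -scalerAr scalerA.
  by rewrite -!exprS; ring.
transitivity (w *: 'X * G + (1 - w *: 'X) * - ('X * G^`())).
  by rewrite -!mul_polyC; ring.
set S := \sum_(1 <= k < n.+1) w ^+ k *: 'X^k in geom *.
set P := \sum_(1 <= k < n.+1) (\sum_(j <- s) j ^+ k) *: 'X^k in IHs *.
rewrite IHs; have -> : (1 - w *: 'X) * G * (S + P) =
   (1 - w *: 'X) * G * P + G * ((1 - w *: 'X) * S) by ring.
by rewrite geom -!mul_polyC; ring.
Qed.

Lemma newton_identity (R : comNzRingType) (s : seq R) (n : nat) : (0 < n)%N ->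
  let G := \prod_(w <- s) (1 - w *: 'X) in
  n%:R * G`_n = - \sum_(1 <= k < n.+1) (\sum_(w <- s) w ^+ k) * G`_(n - k).
Proof.
move=> n_gt0 G; have [H /(congr1 (fun q : {poly R} => q`_n))] := newton_log_derivative s n.
rewrite -/G coefN coefXM coefD coefXnM ltnSn addr0 coef_deriv prednK // (gtn_eqF n_gt0) => E.
apply: oppr_inj; rewrite opprK mulr_natl E mulr_sumr coef_sum; apply: eq_big_nat => k /andP[_ hk].
by rewrite -scalerAr coefZ coefMXn ltnNge -ltnS hk.
Qed.

Lemma bernoulli_ineq (R : numDomainType) (x : R) n : 0 <= x -> 1 + n%:R * x <= (1 + x) ^+ n.
Proof.
move=> x0; elim: n => [|n IHn]; first by rewrite mul0r addr0 expr0.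
rewrite exprS; apply: le_trans (ler_wpM2l _ IHn); last by rewrite addr_ge0.
rewrite -natr1 -subr_ge0 (_ : _ - _ = n%:R * x ^+ 2); last by ring.
by rewrite mulr_ge0 ?exprn_ge0.
Qed.

(* A single [t] is isolated by applying to the power sums the polynomial
   vanishing at all the other terms. *)
Lemma power_sums_bound (C : archiClosedFieldType) (s : seq C) (B q : C) :
  0 < q -> (forall n, (0 < n)%N -> `|\sum_(z <- s) z ^+ n| <= B * q ^+ n) ->
  forall t, t \in s -> `|t| <= q.
Proof.
move=> q_gt0 hB t ts; have B_ge0 : 0 <= B.
  by have := le_trans (normr_ge0 _) (hB 1%N isT); rewrite pmulr_lge0 // exprn_gt0.
pose A : {poly C} := \prod_(z <- undup s | z != t) ('X - z%:P).
have At : A.[t] != 0.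
  rewrite horner_prod prodf_seq_neq0; apply/allP => z _; apply/implyP => zt.
  by rewrite hornerXsubC subr_eq0 eq_sym.
have Az z : z \in s -> z != t -> A.[z] = 0.
  move=> zs zt; rewrite horner_prod; apply/eqP; rewrite prodf_seq_eq0.
  by apply/hasP; exists z; rewrite ?mem_undup // zt hornerXsubC subrr eqxx.
have key n : (0 < n)%N -> (count_mem t s)%:R * (t ^+ n * A.[t]) =
    \sum_(j < size A) A`_j * \sum_(z <- s) z ^+ (n + j).
  move=> n_gt0; under [RHS]eq_bigr => j _ do rewrite mulr_sumr.
  rewrite exchange_big /= (eq_big_seq (fun z => (z == t)%:R * (t ^+ n * A.[t]))).
    rewrite -mulr_suml -natr_sum -sum1_count [in LHS]big_mkcond /=; congr (_%:R * _).
  move=> z zs; have -> : \sum_(j < size A) A`_j * z ^+ (n + j) = z ^+ n * A.[z].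
    by rewrite horner_coef mulr_sumr; apply: eq_bigr => j _; rewrite exprD mulrCA.
  by case: eqVneq => [->|zt]; rewrite ?mul1r // Az // mulr0 mul0r.
pose B1 := (\sum_(j < size A) `|A`_j| * (B * q ^+ j)) / `|A.[t]|.
have cnt : (0 < count_mem t s)%N by rewrite -has_count has_pred1.
have bnd n : (0 < n)%N -> `|t| ^+ n <= B1 * q ^+ n.
  move=> n_gt0; rewrite /B1 mulrAC ler_pdivlMr ?normr_gt0 //.
  apply: le_trans (_ : `|(count_mem t s)%:R * (t ^+ n * A.[t])| <= _).
    rewrite !normrM normrX normr_nat ler_peMl ?mulr_ge0 ?exprn_ge0 //.
    by rewrite ler1n.
  rewrite key // mulr_suml; apply: le_trans (ler_norm_sum _ _ _) _.
  apply: ler_sum => j _; rewrite normrM -mulrA ler_wpM2l //.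
  by rewrite -mulrA -exprD addnC hB // addn_gt0 n_gt0 ?orbT.
rewrite real_leNgt ?realE ?normr_ge0 ?(ltW q_gt0) //; apply/negP => lt_qt.
(* If [|t|] exceeded [q], the bounded powers of [|t| / q = 1 + y] would grow at least linearly in
   [n]. *)
pose y := `|t| / q - 1; have y_gt0 : 0 < y by rewrite subr_gt0 ltr_pdivlMr ?mul1r.
have bnd2 n : (0 < n)%N -> n%:R * y <= B1.
  move=> n_gt0; apply: le_trans (_ : (1 + y) ^+ n <= _).
    by apply: le_trans (bernoulli_ineq n (ltW y_gt0)); rewrite lerDr.
  by rewrite /y addrC subrK expr_div_n ler_pdivrMr ?exprn_gt0 // bnd.
have B1_ge0 : 0 <= B1 / y.
  rewrite divr_ge0 ?(ltW y_gt0) //.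
  by apply: le_trans (bnd2 1%N isT); rewrite mul1r ltW.
have := archi_boundP B1_ge0; rewrite ltr_pdivrMr //.
set m := Num.bound _ => lt_m; have := le_lt_trans (bnd2 m.+1 isT) lt_m.
by rewrite ltr_pM2r // ltr_nat ltnNge leqnSn.
Qed.

(** The coefficient next to the leading one is minus the sum of the roots. Multiplying by ['X]
    before reading it off makes it 0 for the constant 1. *)
Lemma coef_second_monicM (R : comNzRingType) (g h : {poly R}) :
  g \is monic -> h \is monic ->
  (g * h * 'X)`_(size (g * h)).-1 = (g * 'X)`_(size g).-1 + (h * 'X)`_(size h).-1.
Proof.
wlog: g h / (size h <= size g)%N => [W|].
  have [/W//|/ltnW/W E] := leqP (size h) (size g).
  by move=> gm hm; rewrite [g * h]mulrC addrC E.
move=> le_hg g_monic h_monic.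
have g_gt0 : (0 < size g)%N by rewrite size_poly_gt0 monic_neq0.
have h_gt0 : (0 < size h)%N by rewrite size_poly_gt0 monic_neq0.
rewrite size_monicM ?monic_neq0 //.
have [h1|h_gt1] := leqP (size h) 1.
  have -> : h = 1.
    rewrite [h]size1_polyC //; congr (_%:P); move/monicP: h_monic.
    by rewrite /lead_coef; case: (size h) h1 h_gt0 => [|[|]].
  by rewrite size_poly1 mulr1 addn1 mul1r /= coefX addr0.
rewrite !coefMX; have -> /= : ((size g + size h).-1.-1 == 0)%N = false by lia.
have -> /= : ((size g).-1 == 0)%N = false by lia.
have -> /= : ((size h).-1 == 0)%N = false by lia.
pose m := (size g).-2; pose n := (size h).-2.
have gm : g`_m.+1 = 1.
  by have /monicP := g_monic; rewrite /lead_coef; congr (_`_ _ = _); rewrite /m; lia.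
have hn : h`_n.+1 = 1.
  by have /monicP := h_monic; rewrite /lead_coef; congr (_`_ _ = _); rewrite /n; lia.
have -> : (size g + size h).-1.-1.-1 = (m + n.+1)%N by rewrite /m /n; lia.
rewrite -/m -/n coefM (bigD1 (inord m)) //= (bigD1 (inord m.+1)) /=; last first.
  by rewrite -val_eqE /= !inordK; lia.
rewrite !inordK; try lia.
have -> : (m + n.+1 - m = n.+1)%N by lia.
rewrite hn mulr1 [X in _ + (_ + X)]big1 => [|i]; last first.
  rewrite -!val_eqE /= !inordK; try lia.
  move=> ne; have [lt_im|] := ltnP i m.
    rewrite [h`__]nth_default ?mulr0 //.
    have -> : size h = n.+2 by rewrite /n; lia.
    by lia.
  move=> le_mi; rewrite [g`__]nth_default ?mul0r //.
  have : size g = m.+2 by rewrite /m; lia.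
  by move=> ->; move: ne le_mi => /andP[/eqP ne1 /eqP ne2]; lia.
by rewrite gm mul1r addr0; congr (_ + h`_ _); lia.
Qed.

Lemma artin_schreier_root (W : closedFieldType) (p : nat) (y : W) : (1 < p)%N ->
  exists z : W, z ^+ p - z == y.
Proof.
move=> p_gt1; have sz : size ('X^p - 'X - y%:P : {poly W}) = p.+1.
  by rewrite -addrA size_polyDl size_polyXn // -opprD size_polyN size_XaddC.
have /closed_rootP[z] : size ('X^p - 'X - y%:P : {poly W}) != 1%N by rewrite sz; lia.
by rewrite rootE !hornerE subr_eq0 => h; exists z.
Qed.

Section MonicPoly.
Variable F : finFieldType.

Definition monic_of n (v : 'rV[F]_n) : {poly F} := 'X^n + rVpoly v.

Lemma size_monic_of n v : size (@monic_of n v) = n.+1.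
Proof. by rewrite /monic_of size_polyDl size_polyXn // ltnS size_poly. Qed.

Lemma monic_monic_of n v : @monic_of n v \is monic.
Proof.
apply/monicP; rewrite /monic_of lead_coefDl ?lead_coefXn //.
by rewrite size_polyXn ltnS size_poly.
Qed.

Lemma monic_ofK n (h : {poly F}) : h \is monic -> size h = n.+1 ->
  monic_of (poly_rV (h - 'X^n) : 'rV_n) = h.
Proof.
move=> /monicP; rewrite /lead_coef => h_monic sz_h; rewrite sz_h /= in h_monic.
rewrite /monic_of poly_rV_K; first by rewrite addrC subrK.
apply/leq_sizeP => i le_ni.
rewrite coefB coefXn; have [->|ne] := eqVneq i n; first by rewrite h_monic subrr.
by rewrite nth_default ?subr0 // sz_h; lia.
Qed.

Lemma poly_rV_monic_of n (v : 'rV[F]_n) : poly_rV (monic_of v - 'X^n) = v.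
Proof. by rewrite /monic_of addrC addKr rVpolyK. Qed.

(** Division by [P] is a bijection onto the monic polynomials of degree [n - k]. *)
Lemma sum_monic_dvdp (R : nmodType) n k (P : {poly F}) (f : {poly F} -> R) :
  P \is monic -> size P = k.+1 -> (k <= n)%N ->
  \sum_(v : 'rV[F]_n | P %| monic_of v) f (monic_of v) =
  \sum_(w : 'rV[F]_(n - k)) f (P * monic_of w).
Proof.
move=> P_monic sz_P le_kn; have P_neq0 := monic_neq0 P_monic.
have szM (w : 'rV[F]_(n - k)) : size (P * monic_of w) = n.+1.
  by rewrite size_monicM ?monic_neq0 ?monic_monic_of // sz_P size_monic_of; lia.
have monM (w : 'rV[F]_(n - k)) : P * monic_of w \is monic.
  by rewrite monicMr ?monic_monic_of.
rewrite (reindex_onto (fun w : 'rV[F]_(n - k) => poly_rV (P * monic_of w - 'X^n) : 'rV_n)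
  (fun v => poly_rV (monic_of v %/ P - 'X^(n - k)))) /=.
  apply: eq_big => [w|w _]; rewrite !monic_ofK //.
  by rewrite dvdp_mulr //= mulKp // poly_rV_monic_of eqxx.
move=> v dvd_v; rewrite monic_ofK.
- by rewrite mulrC divpK // poly_rV_monic_of.
- by rewrite -(monicMr _ P_monic) divpK // monic_monic_of.
by rewrite size_divp // size_monic_of sz_P /= subSn.
Qed.

End MonicPoly.

Section LFunction.
Variables (C : archiClosedFieldType) (p : nat) (p_pr : prime p).
Variables (chi psi : 'F_p -> C).
Hypotheses (chiM : {morph chi : x y / x * y}) (chi1 : chi 1 = 1) (chi0 : chi 0 = 0).
Hypothesis chi_nontrivial : exists2 w, w != 0 & chi w != 1.
Hypotheses (psiD : {morph psi : x y / x + y >-> x * y}) (psi0 : psi 0 = 1).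
Hypotheses (chi_le1 : forall x, `|chi x| <= 1) (psi_le1 : forall x, `|psi x| <= 1).
Variable al : seq 'F_p.
Hypotheses (al_uniq : uniq al) (al_gt0 : (0 < size al)%N).
Let d := size al.

(** For [h] with roots x_i the arguments are the product of all [a - x_i] and the sum of the x_i.
    Hence the term is multiplicative in [h], and for a characteristic polynomial it involves a norm
    and a trace. *)
Definition Lterm (h : {poly 'F_p}) : C :=
  chi (\prod_(a <- al) h.[a]) * psi (- (h * 'X)`_(size h).-1).

Lemma LtermM g h : g \is monic -> h \is monic -> Lterm (g * h) = Lterm g * Lterm h.
Proof.
move=> gm hm; rewrite /Lterm coef_second_monicM // opprD psiD mulrACA -chiM.
by congr (chi _ * _); rewrite -big_split; apply: eq_bigr => a _; rewrite hornerM.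
Qed.

Definition Lcoef n := \sum_(v : 'rV['F_p]_n) Lterm (monic_of v).

Lemma Lcoef0 : Lcoef 0 = 1.
Proof.
rewrite /Lcoef (eq_bigr (fun=> 1)) => [|v _]; last first.
  rewrite /monic_of expr0.
  have -> : rVpoly v = 0 by rewrite (_ : v = 0) ?linear0 //; apply/rowP => - [].
  rewrite addr0 /Lterm size_poly1 mul1r coefX oppr0 psi0 mulr1 big1 // => a _.
  by rewrite hornerC.
by rewrite sumr_const card_mx expn0.
Qed.

(* Rescaling the value of h at the first point by [w] permutes the polynomials
   of degree n and multiplies the coefficient by [chi w]. *)
Lemma Lcoef_eq0 n : (d < n)%N -> Lcoef n = 0.
Proof.
move=> lt_dn; have [w w_neq0 chiw] := chi_nontrivial.
pose a := head 0 al; have aal : a \in al.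
  by rewrite /a; case: (al) al_gt0 => // b s _; rewrite mem_head.
pose l0 : {poly 'F_p} := \prod_(b <- rem a al) ('X - b%:P).
have memr b : (b \in rem a al) = (b != a) && (b \in al).
  by rewrite mem_rem_uniq // inE.
have l0a : l0.[a] != 0.
  rewrite /l0 horner_prod prodf_seq_neq0; apply/allP => b /=.
  by rewrite memr hornerXsubC subr_eq0 eq_sym => /andP[].
pose l1 := l0.[a]^-1 *: l0.
have l1a : l1.[a] = 1 by rewrite hornerZ mulVf.
have l1b b : b \in al -> b != a -> l1.[b] = 0.
  move=> bal ba; rewrite hornerZ; apply/eqP; rewrite mulf_eq0; apply/orP; right.
  by rewrite -rootE root_prod_XsubC memr ba.
(* The Lagrange polynomial [l1] has degree at most [n - 2], so adding a multiple of it changes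
   neither the leading coefficient nor the one seen by [psi]. *)
have sz_l1 : (size l1 <= n.-1)%N.
  apply: leq_trans (size_scale_leq _ _) _; rewrite /l0 size_prod_XsubC size_rem //.
  by rewrite prednK // -/d; case: (n) lt_dn.
have n_gt0 : (0 < n)%N by lia.
pose T (v : 'rV['F_p]_n) := v + ((w - 1) * (monic_of v).[a]) *: poly_rV l1.
have TE v : monic_of (T v) = monic_of v + ((w - 1) * (monic_of v).[a]) *: l1.
  rewrite {1}/monic_of /T linearD linearZ /= poly_rV_K ?addrA //.
  by apply: leq_trans sz_l1 _; lia.
have Ta v : (monic_of (T v)).[a] = w * (monic_of v).[a].
  by rewrite TE hornerD hornerZ l1a mulr1 mulrBl mul1r addrCA subrr addr0.
have T_inj : injective T.
  move=> v1 v2 E; have := Ta v1; rewrite E Ta => /(mulfI w_neq0) Ea.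
  by move: E; rewrite /T Ea => /addIr.
have LT v : Lterm (monic_of (T v)) = chi w * Lterm (monic_of v).
  rewrite /Lterm !size_monic_of !coefMX (gtn_eqF n_gt0) {2}TE coefD coefZ.
  rewrite [l1`_ _]nth_default // mulr0 addr0 mulrA -chiM; congr (chi _ * _).
  rewrite !(big_rem a aal) /= Ta mulrA; congr (_ * _); apply: eq_big_seq => b.
  by rewrite memr => /andP[ba bal]; rewrite TE hornerD hornerZ l1b // mulr0 addr0.
have : (1 - chi w) * Lcoef n = 0.
  rewrite mulrBl mul1r {1}/Lcoef (reindex_inj T_inj) mulr_sumr.
  by rewrite (eq_bigr _ (fun v _ => LT v)) subrr.
by move/eqP; rewrite mulf_eq0 subr_eq0 eq_sym (negbTE chiw) => /eqP.
Qed.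

Lemma coef_Lpoly n : (\poly_(i < d.+1) Lcoef i)`_n = Lcoef n.
Proof. by rewrite coef_poly; case: ltnP => // /Lcoef_eq0->. Qed.

(** The [w] are the reciprocals of the roots, which are nonzero because the constant coefficient is
    1. *)
Lemma Lpoly_factor : exists2 s : seq C, (size s <= d)%N &
  forall n, (\prod_(w <- s) (1 - w *: 'X))`_n = Lcoef n.
Proof.
pose G : {poly C} := \poly_(i < d.+1) Lcoef i.
have [r GE] := closed_field_poly_normal G.
have G0 : G.[0] = 1 by rewrite horner_coef0 coef_Lpoly Lcoef0.
have G_neq0 : G != 0 by apply: contra_eq_neq G0 => ->; rewrite horner0 eq_sym oner_eq0.
have r_neq0 z : z \in r -> z != 0.
  move=> zr; apply: contra_eq_neq G0 => z0; move: zr; rewrite z0 => zr.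
  rewrite GE hornerZ horner_prod (big_rem 0 zr) /= hornerXsubC subrr mul0r mulr0.
  by rewrite eq_sym oner_eq0.
exists [seq z^-1 | z <- r].
  rewrite size_map -ltnS -(size_prod_XsubC r id) -(size_scale _ (_ : lead_coef G != 0)).
    by rewrite -GE size_poly.
  by rewrite lead_coef_eq0.
move=> n; rewrite -coef_Lpoly -/G.
suff -> : \prod_(w <- [seq z^-1 | z <- r]) (1 - w *: 'X) = G by [].
have E : \prod_(z <- r) ('X - z%:P) = (\prod_(z <- r) (- z)) *: \prod_(z <- r) (1 - z^-1 *: 'X).
  rewrite -mul_polyC rmorph_prod -big_split /=; apply: eq_big_seq => z zr.
  rewrite mul_polyC scalerBr scalerA mulNr divff ?r_neq0 // scaleN1r opprK addrC.
  by rewrite scaleNr alg_polyC.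
rewrite big_map [RHS]GE E scalerA [_ * _](_ : _ = 1) ?scale1r //.
rewrite -[RHS]G0 [in RHS]GE E !hornerZ horner_prod [X in _ * (_ * X)]big1 ?mulr1 // => z _.
by rewrite hornerD hornerN hornerZ hornerX hornerC mulr0 subr0.
Qed.

Variables (W : closedFieldType) (iota : {rmorphism 'F_p -> W}).
Local Notation pts := (@frob_points p W).
Local Notation cpF := (frob_cpolyF iota).

Definition Lsum k := \sum_(x <- pts k) Lterm (cpF k x).

(** By [frob_count] each monic [h] of degree [n] is divisible by the characteristic polynomials of
    exactly [n] pairs [(k, x)]. For a fixed pair the cofactor runs over all monic polynomials of
    degree [n - k]. *)
Lemma Lcoef_rec n : n%:R * Lcoef n = \sum_(1 <= k < n.+1) Lsum k * Lcoef (n - k).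
Proof.
have step k : (1 <= k < n.+1)%N -> Lsum k * Lcoef (n - k) =
    \sum_(v : 'rV['F_p]_n) \sum_(x <- pts k) (nat_of_bool (cpF k x %| monic_of v)%R)%:R * Lterm (monic_of v).
  move=> /andP[k_gt0 le_kn]; rewrite exchange_big /= /Lsum mulr_suml.
  apply: eq_big_seq => x; rewrite mem_frob_points // => /eqP xk.
  have P_monic := monic_frob_cpolyF p_pr iota xk.
  have sz_P := size_frob_cpolyF p_pr iota xk.
  transitivity (\sum_(v : 'rV['F_p]_n | cpF k x %| monic_of v) Lterm (monic_of v)).
    rewrite (sum_monic_dvdp _ P_monic sz_P) ?mulr_sumr //.
    by apply: eq_bigr => v _; rewrite LtermM ?monic_monic_of.
  by rewrite big_mkcond; apply: eq_bigr => v _; case: ifP; rewrite ?mul1r ?mul0r.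
rewrite (eq_big_nat _ _ step) exchange_big /= /Lcoef mulr_sumr; apply: eq_bigr => v _.
under eq_bigr => k _ do rewrite -mulr_suml -natr_sum.
rewrite -mulr_suml -natr_sum -(size_monic_of v) (frob_count p_pr iota) ?monic_monic_of //.
by rewrite size_monic_of.
Qed.

(** [Lcoef_rec] is Newton's identity for the reciprocal roots with minus [Lsum] in place of the
    power sums; as [Lcoef 0 = 1], it determines them one after the other. *)
Lemma Lsum_roots : exists2 s : seq C, (size s <= d)%N &
  forall k, (0 < k)%N -> Lsum k = - \sum_(w <- s) w ^+ k.
Proof.
have [s sz_s sE] := Lpoly_factor; exists s => //; elim/ltn_ind => n IHn n_gt0.
have := newton_identity s n_gt0; rewrite /= sE Lcoef_rec.
rewrite !(@big_nat_recr _ _ _ n) //= !subnn !sE Lcoef0 !mulr1 opprD.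
rewrite (eq_big_nat _ _ (_ : forall k, (1 <= k < n)%N -> _ =
  - ((\sum_(w <- s) w ^+ k) * (\prod_(w <- s) (1 - w *: 'X))`_(n - k)))).
  by rewrite sumrN => /addrI.
by move=> k /andP[k_gt0 lt_kn]; rewrite IHn // mulNr sE.
Qed.


Lemma Lterm_cpF k x : (0 < k)%N -> x ^+ (p ^ k) = x ->
  [/\ iota (\prod_(a <- al) (cpF k x).[a]) =
        (\prod_(a <- al) (iota a - x)) ^+ (\sum_(i < k) p ^ i)
    & iota (- (cpF k x * 'X)`_(size (cpF k x)).-1) = \sum_(i < k) x ^+ (p ^ i)].
Proof.
move=> k_gt0 xk; split.
  rewrite rmorph_prod -prodrXl; apply: eq_bigr => a _.
  rewrite -horner_map map_frob_cpolyF // /frob_cpoly horner_prod expr_sum.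
  apply: eq_bigr => i _; rewrite hornerXsubC exprB_pow //; congr (_ - _).
  rewrite -rmorphXn; congr (iota _).
  by elim: (nat_of_ord i) => [|j IHj]; rewrite ?expr1 // expnSr exprM -IHj expr_Fp.
rewrite size_frob_cpolyF // coefMX (gtn_eqF k_gt0) rmorphN -coef_map map_frob_cpolyF //.
rewrite /frob_cpoly -big_enum /= -(big_map (fun i : 'I_k => x ^+ (p ^ i)) xpredT (fun z => 'X - z%:P)).
set s := [seq x ^+ (p ^ nat_of_ord i) | i <- _].
have sz : size s = k by rewrite size_map size_enum_ord.
have := @coefPn_prod_XsubC _ s; rewrite sz -lt0n => -> //.
by rewrite opprK /s big_map big_enum.
Qed.

Hypothesis p_gt2 : (2 < p)%N.

Let normF k x : 'F_p := \prod_(a <- al) (cpF k x).[a].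
Let traceF k x : 'F_p := - (cpF k x * 'X)`_(size (cpF k x)).-1.

(* Writing x = z ^ p - z + c removes the trace condition and leaves an equation
   in z to which [stepanov_bound] applies. *)
Lemma norm_trace_count s (u v : 'F_p) : (0 < s)%N -> u != 0 ->
  (p.-1 * (count (fun x => (normF s.*2 x == u) && (traceF s.*2 x == v)) (pts s.*2) * p)
   <= p ^ s.*2 + p.-1 * (3 * (d * p) + 4) * p ^ s)%N.
Proof.
move=> s_gt0 u_neq0; set k := s.*2; have k_gt0 : (0 < k)%N by rewrite double_gt0.
have p_gt1 := prime_gt1 p_pr.
rewrite -size_filter; set X := seq.filter _ _.
have X_uniq : uniq X by rewrite filter_uniq // uniq_frob_points.
have XP x : x \in X -> [/\ x ^+ (p ^ k) = x, normF k x = u & traceF k x = v].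
  by rewrite mem_filter mem_frob_points // => /andP[/andP[/eqP-> /eqP->] /eqP->].
have [X0|X_neq0] := posnP (size X); first by rewrite X0 mul0n muln0.
have /hasP[c cX _] : has predT X by rewrite has_predT.
have [ck _ cv] := XP c cX.
have as_root y : {z : W | z ^+ p - z = y}.
  by have [z /eqP zE] := sigW (artin_schreier_root y p_gt1); exists z.
pose zr y := sval (as_root y); have zrE y : zr y ^+ p - zr y = y := svalP (as_root y).
(* Each [x] has p preimages under [z ^ p - z + c], one for each [y]. They lie in the field with
   [p ^ k] elements because [x] and [c] have the same trace. *)
pose Z := [seq zr (x - c) + iota y | x <- X, y <- enum 'F_p].
have zp x y : (zr (x - c) + iota y) ^+ p - (zr (x - c) + iota y) = x - c.
  have := exprD_pow p_pr iota 1 (zr (x - c)) (iota y); rewrite expn1 => ->.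
  by rewrite -rmorphXn expr_Fp // opprD addrACA subrr addr0 zrE.
have Z_uniq : uniq Z.
  apply: allpairs_uniq => //; first exact: enum_uniq.
  move=> [x1 y1] [x2 y2] _ _ /= E; have := zp x1 y1; rewrite E zp => /addIr Ex.
  by move: E; rewrite Ex => /addrI/fmorph_inj->.
have -> : (size X * p = size Z)%N by rewrite size_allpairs -cardE card_Fp.
pose F : {poly W} := \prod_(a <- al) ((iota a)%:P - ('X^p - 'X + c%:P)).
have FE z : F.[z] = \prod_(a <- al) (iota a - (z ^+ p - z + c)).
  by rewrite /F horner_prod; apply: eq_bigr => a _; rewrite !hornerE.
pose a1 := head 0 al; have a1al : a1 \in al.
  by rewrite /a1; case: (al) al_gt0 => // b r _; rewrite mem_head.
pose beta := zr (iota a1 - c).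
(* The factor of [F] at [a1] is [(X - beta) - (X - beta) ^ p]. The factors at the other points of
   [al] differ from it by nonzero constants, so [beta] is a simple root. *)
pose F1 : {poly W} := (1 - ('X - beta%:P) ^+ p.-1) *
  \prod_(a <- rem a1 al) ((iota a)%:P - ('X^p - 'X + c%:P)).
have F_eq : F = ('X - beta%:P) * F1.
  rewrite /F (big_rem a1 a1al) /= /F1 mulrA; congr (_ * _).
  rewrite mulrBr mulr1 -exprS prednK; last by lia.
  have -> : ('X - beta%:P) ^+ p = 'X^p - (beta ^+ p)%:P.
    have pP : p \in [pchar {poly W}] by rewrite pchar_poly (pchar_closure p_pr iota).
    rewrite -pFrobenius_autE -/(_ pP) pFrobenius_autB_comm; last exact: mulrC.
    by rewrite !pFrobenius_autE rmorphXn.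
  have -> : iota a1 = beta ^+ p - beta + c by rewrite zrE subrK.
  by rewrite !rmorphD rmorphN /=; ring.
have F1_beta : ~~ root F1 beta.
  rewrite rootE /F1 hornerM mulf_eq0 negb_or !hornerE subrr expr0n gtn_eqF ?subr0 ?oner_eq0 //=; last by lia.
  rewrite horner_prod prodf_seq_neq0; apply/allP => a; rewrite mem_rem_uniq // inE => /andP[aa _].
  by rewrite !hornerE zrE subrK subr_eq0 fmorph_eq.
have szF : (size F <= (d * p).+1)%N.
  rewrite /F /d; elim: (al) => [|a r IHr]; first by rewrite big_nil size_poly1.
  rewrite big_cons /= mulSn; apply: size_mul_leqS IHr.
  apply: leq_trans (size_polyD _ _) _; rewrite geq_max size_polyN.
  rewrite (leq_trans (size_polyC_leq1 _)) //=.
  rewrite -addrA size_polyDl size_polyXn // addrC -opprB size_polyN size_XsubC.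
  by lia.
apply: (stepanov_bound (pchar_closure p_pr iota) p_gt2 s_gt0 szF F_eq F1_beta
   (_ : iota u != 0) Z_uniq); first by rewrite fmorph_eq0.
move=> _ /allpairsP[[x y] /= [xX _ ->]]; have [xk xu xv] := XP x xX.
have [Ex1 Ex2] := Lterm_cpF k_gt0 xk; have [_ Ec2] := Lterm_cpF k_gt0 ck.
split; last by rewrite FE zp subrK -xu -Ex1.
set z := _ + iota y; apply/eqP; rewrite -subr_eq0.
(* The difference telescopes into the conjugates of [z ^ p - z = x - c], whose sum is the trace of
   [x] minus that of [c]. *)
have -> : z ^+ (p ^ s.*2) - z = \sum_(i < k) (z ^+ p - z) ^+ (p ^ i).
  rewrite -/k; elim: (k) => [|m IHm]; first by rewrite big_ord0 subrr.
  rewrite big_ord_recr /= -IHm exprB_pow // -exprM -expnS addrC.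
  by rewrite addrA subrK.
rewrite zp (eq_bigr (fun i : 'I_k => x ^+ (p ^ i) - c ^+ (p ^ i))) => [|i _]; last first.
  by rewrite exprB_pow.
by rewrite sumrB -Ex2 -Ec2 [X in iota X - _]xv [X in _ - iota X]cv subrr.
Qed.

Let sum_chi : \sum_u chi u = 0.
Proof.
have [w w_neq0 chiw] := chi_nontrivial.
have : (1 - chi w) * \sum_u chi u = 0.
  rewrite mulrBl mul1r {1}(reindex_inj (mulfI w_neq0)) mulr_sumr.
  by rewrite (eq_bigr _ (fun u _ => chiM w u)) subrr.
by move/eqP; rewrite mulf_eq0 subr_eq0 eq_sym (negbTE chiw) => /eqP.
Qed.

(** Only an upper bound on each [M t] is known. Since [g] sums to zero, [w * M t] may be replaced by
    its defect [B0 - w * M t >= 0]; the defects have a small total because the [M t] add up to at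
    least [p ^ k - d], only the points of [al] having norm 0. *)
Lemma Lsum_bound s : (0 < s)%N ->
  `|Lsum s.*2| <= (p.-1 * (3 * (d * p) + 4) + d)%:R * p%:R ^+ s.
Proof.
move=> s_gt0; set k := s.*2; have k_gt0 : (0 < k)%N by rewrite double_gt0.
pose g (t : 'F_p * 'F_p) := chi t.1 * psi t.2.
pose nt x := (normF k x, traceF k x).
pose M t := count (fun x => nt x == t) (pts k).
have LE : Lsum k = \sum_(t | t.1 != 0) g t * (M t)%:R.
  rewrite /Lsum (partition_big nt xpredT) //= [LHS](bigID (fun t => t.1 != 0)) /= addrC big1.
    rewrite add0r; apply: eq_bigr => t _; rewrite /M -sum1_count natr_sum mulr_sumr.
    by apply: eq_bigr => x /eqP <-; rewrite mulr1.
  move=> t; rewrite negbK => /eqP t0; apply: big1 => x /eqP xt.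
  by rewrite /Lterm -/(normF k x) -/(traceF k x) -[normF k x]/((nt x).1) xt t0 chi0 mul0r.
pose w := (p.-1 * p)%N; pose c1 := (p.-1 * (3 * (d * p) + 4))%N.
pose B0 := (p ^ k + c1 * p ^ s)%N.
have card_t : (\sum_(t : 'F_p * 'F_p | t.1 != 0%R) 1 = w)%N.
  transitivity (\sum_(u : 'F_p | u != 0%R) \sum_(v : 'F_p) 1)%N.
    by rewrite pair_big; apply: eq_bigl => t; rewrite andbT.
  under eq_bigr => u _ do rewrite sum1_card card_Fp //.
  rewrite sum_nat_const; congr (_ * _)%N.
  by have := cardC1 (0 : 'F_p); rewrite card_Fp.
have M_le t : t.1 != 0 -> (w * M t <= B0)%N.
  case: t => u v /= u0; have := @norm_trace_count s u v s_gt0 u0.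
  rewrite -/k -/c1 -/B0 (_ : count _ _ = M (u, v)); last exact: eq_count.
  by rewrite /w mulnAC -mulnA.
have w_gt0 : (0 < w)%N by rewrite muln_gt0; lia.
have sum_g : \sum_(t | t.1 != 0) g t = 0.
  transitivity (\sum_(u | u != 0) \sum_v chi u * psi v).
    by rewrite pair_big; apply: eq_bigl => t; rewrite andbT.
  under eq_bigr => u _ do rewrite -mulr_sumr.
  rewrite -mulr_suml; have := sum_chi; rewrite (bigD1 0) //= chi0 add0r => ->.
  by rewrite mul0r.
have M_sum : (p ^ k <= \sum_(t | t.1 != 0%R) M t + d)%N.
  have -> : (\sum_(t | t.1 != 0%R) M t = count (fun x => normF k x != 0%R) (pts k))%N.
    rewrite -sum1_count (partition_big nt (fun t => t.1 != 0)) //=.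
    apply: eq_bigr => t t0; rewrite /M -sum1_count; apply: eq_bigl => x.
    by case: eqP => [E|]; rewrite ?andbF // andbT -[normF k x]/((nt x).1) E t0.
  rewrite -(size_frob_points p_pr W k_gt0) -(count_predC (fun x => normF k x != 0)) leq_add2l.
  rewrite -size_filter /d -(size_map iota al); apply: uniq_leq_size.
    by rewrite filter_uniq // (uniq_frob_points p_pr iota).
  move=> x; rewrite mem_filter mem_frob_points //= negbK => /andP[/eqP nx0 /eqP xk].
  have [E _] := Lterm_cpF k_gt0 xk; move: E; rewrite -/(normF k x) nx0 rmorph0 => /esym/eqP.
  rewrite expf_eq0 => /andP[_]; rewrite prodf_seq_eq0 => /hasP[a aal].
  by rewrite subr_eq0 => /eqP <-; rewrite map_f.
have key : w%:R * `|Lsum k| <= w%:R * (c1 * p ^ s + d)%:R.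
  rewrite -[w%:R]normr_nat -normrM LE mulr_sumr normr_nat.
  have -> : \sum_(t | t.1 != 0) w%:R * (g t * (M t)%:R) =
     - \sum_(t | t.1 != 0) g t * (B0 - w * M t)%:R.
    apply/eqP; rewrite -addr_eq0 -big_split /= (eq_bigr (fun t => g t * B0%:R)).
      by rewrite -mulr_suml sum_g mul0r.
    by move=> t t0; rewrite natrB ?M_le // natrM; ring.
  rewrite normrN; apply: le_trans (ler_norm_sum _ _ _) _.
  apply: le_trans (_ : \sum_(t : 'F_p * 'F_p | t.1 != 0) (B0 - w * M t)%:R <= _).
    apply: ler_sum => t _; rewrite !normrM normr_nat ler_piMl // -[1]mulr1.
    by rewrite ler_pM.
  rewrite -natr_sum -natrM ler_nat.
  rewrite -(leq_add2r (w * \sum_(t | t.1 != 0%R) M t)).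
  have -> : (\sum_(t | t.1 != 0%R) (B0 - w * M t) + w * \sum_(t | t.1 != 0%R) M t = w * B0)%N.
    rewrite big_distrr -big_split /= -[in RHS]card_t big_distrl /=.
    by apply: eq_bigr => t t0; rewrite mul1n subnK // M_le.
  by rewrite -mulnDr leq_mul2l /B0 addnC -addnA leq_add2l addnC M_sum orbT.
rewrite ler_pM2l ?ltr0n // in key; apply: le_trans key _.
rewrite -natrX -natrM ler_nat -/c1 mulnDl leq_add2l leq_pmulr // expn_gt0.
by rewrite (prime_gt0 p_pr).
Qed.

Lemma weil_bound_closure :
  `|\sum_x chi (\prod_(a <- al) (a - x)) * psi x| <= d%:R * sqrtC p%:R.
Proof.
have -> : \sum_x chi (\prod_(a <- al) (a - x)) * psi x = Lsum 1.
  rewrite /Lsum; have pe : perm_eq (pts 1) [seq iota y | y <- enum 'F_p].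
    apply: uniq_perm; first exact: (uniq_frob_points p_pr iota).
      by rewrite map_inj_uniq ?enum_uniq //; apply: fmorph_inj.
    move=> x; rewrite mem_frob_points // expn1; apply/eqP/mapP => [xp|[y _ ->]].
      by have [y yx] := frob_fixedP p_pr iota xp; exists y; rewrite ?mem_enum.
    by rewrite -rmorphXn expr_Fp.
  rewrite (perm_big _ pe) big_map big_enum /=; apply: eq_bigr => y _; rewrite /Lterm.
  have y1 : iota y ^+ (p ^ 1) = iota y by rewrite expn1 -rmorphXn expr_Fp.
  have [E1 E2] := @Lterm_cpF 1%N _ isT y1; move: E1 E2; rewrite !big_ord1 !expr1.
  have -> : \prod_(a <- al) (iota a - iota y) = iota (\prod_(a <- al) (a - y)).
    by rewrite rmorph_prod; apply: eq_bigr => a _; rewrite rmorphB.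
  by move=> /fmorph_inj-> /fmorph_inj->.
have [s sz_s sE] := Lsum_roots.
have p_gt0 : 0 < p%:R :> C by rewrite ltr0n prime_gt0.
rewrite sE // normrN; apply: le_trans (ler_norm_sum _ _ _) _.
apply: le_trans (_ : (size s)%:R * sqrtC p%:R <= _); last first.
  by rewrite ler_wpM2r ?sqrtC_ge0 ?ler0n // ler_nat.
have <- : \sum_(w <- s) sqrtC p%:R = (size s)%:R * sqrtC p%:R :> C.
  by rewrite big_const_seq count_predT iter_addr_0 mulr_natl.
rewrite big_seq [leRHS]big_seq; apply: ler_sum => w ws.
(* [Lsum_bound] covers even exponents only, so the power sums are those of the squares. Its constant
   is independent of the exponent and disappears. *)
have : `|w ^+ 2| <= p%:R.
  apply: (@power_sums_bound C [seq w ^+ 2 | w <- s]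
    ((p.-1 * (3 * (d * p) + 4) + d)%:R) p%:R p_gt0); last exact: map_f.
  move=> n n_gt0; have := Lsum_bound n_gt0; rewrite sE ?double_gt0 // normrN.
  rewrite big_map; congr (`|_| <= _); apply: eq_bigr => z _.
  by rewrite -exprM mul2n.
by rewrite expr1 normrX -{1}(sqrtCK p%:R) ler_pXn2r ?nnegrE ?sqrtC_ge0 ?ler0n.
Qed.

End LFunction.

Theorem weil_bound (C : archiClosedFieldType) (p : nat) (chi psi : 'F_p -> C) (al : seq 'F_p) :
  prime p -> (2 < p)%N ->
  {morph chi : x y / x * y} -> chi 1 = 1 -> chi 0 = 0 -> (exists2 w, w != 0 & chi w != 1) ->
  {morph psi : x y / x + y >-> x * y} -> psi 0 = 1 ->
  (forall x, `|chi x| <= 1) -> (forall x, `|psi x| <= 1) ->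
  uniq al -> (0 < size al)%N ->
  `|\sum_x chi (\prod_(a <- al) (a - x)) * psi x| <= (size al)%:R * sqrtC p%:R.
Proof.
move=> p_pr p_gt2 chiM chi1 chi0 chint psiD psi0 chi_le psi_le alu al0.
have [W [iota _]] := countable_algebraic_closure 'F_p.
exact: (weil_bound_closure p_pr chiM chi1 chi0 chint psiD psi0 chi_le psi_le alu al0 iota p_gt2).
Qed.

(** * Characters of the prime field *)

Lemma prim_root_sum (n : nat) (z : algC) (m : nat) : n.-primitive_root z ->
  \sum_(j < n) z ^+ (j * m) = if (n %| m)%N then n%:R else 0.
Proof.
move=> prim_z; case: ifP => [/dvdnP[k ->]|ndvd].
  rewrite (eq_bigr (fun=> 1)) ?sumr_const ?card_ord // => j _.
  by rewrite mulnA mulnC exprM (prim_expr_order prim_z) expr1n.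
have zm : z ^+ m - 1 != 0.
  by rewrite subr_eq0 -(prim_order_dvd prim_z) ndvd.
apply: (mulfI zm); rewrite mulr0; transitivity ((z ^+ m) ^+ n - 1).
  rewrite [RHS]subrX1; congr (_ * _); apply: eq_bigr => j _.
  by rewrite mulnC exprM.
by rewrite exprAC (prim_expr_order prim_z) expr1n subrr.
Qed.

Lemma prim_root_norm (n : nat) (z : algC) m : n.-primitive_root z -> `|z ^+ m| = 1.
Proof.
move=> prim_z; rewrite normrX; have n_gt0 := prim_order_gt0 prim_z.
suff -> : `|z| = 1 by rewrite expr1n.
apply/eqP; rewrite -(@pexpr_eq1 _ `|z| n) ?normr_ge0 //.
by rewrite -normrX (prim_expr_order prim_z) normr1.
Qed.

Lemma Fp_prim_root p : prime p -> exists g : 'F_p, p.-1.-primitive_root g.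
Proof.
move=> p_pr; pose rs := [seq x : 'F_p <- enum 'F_p | x != 0].
have p1_gt0 : (0 < p.-1)%N by rewrite -subn1 subn_gt0 prime_gt1.
have /hasP[g _ gP] : has p.-1.-primitive_root rs; last by exists g.
apply: has_prim_root => //.
- apply/allP => x; rewrite mem_filter unity_rootE => /andP[x_neq0 _].
  apply/eqP/(mulfI x_neq0); rewrite mulr1 -exprS prednK ?prime_gt0 //.
  exact: expr_Fp.
- by rewrite filter_uniq ?enum_uniq.
have := cardC1 (0 : 'F_p); rewrite card_Fp // => <-.
rewrite cardE; apply: uniq_leq_size; first exact: enum_uniq.
by move=> x; rewrite mem_enum mem_filter mem_enum andbT.
Qed.

Record mult_chars p (chi : 'I_p.-1 -> 'F_p -> algC) (j0 : 'I_p.-1) : Prop := MultChars {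
  mc_mul : forall j, {morph chi j : x y / x * y};
  mc_one : forall j, chi j 1 = 1;
  mc_zero : forall j, chi j 0 = 0;
  mc_norm : forall j x, x != 0 -> `|chi j x| = 1;
  mc_triv : forall x, x != 0 -> chi j0 x = 1;
  mc_nontriv : forall j, j != j0 -> exists2 w, w != 0 & chi j w != 1;
  mc_orth : forall x, x != 0 -> \sum_j chi j x = if x == 1 then p.-1%:R else 0
}.

(** With a generator [g] and a root of unity [z] of order p - 1, the character [chi j] sends [g ^ i]
    to [z ^ (i * j)]. *)
Lemma mult_chars_exist p : prime p -> exists chi j0, @mult_chars p chi j0.
Proof.
move=> p_pr; have [g gP] := Fp_prim_root p_pr.
have p1_gt0 := prim_order_gt0 gP.
have [z zP] := C_prim_root_exists p1_gt0.
have g_neq0 : g != 0.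
  apply: contraTneq gP => ->; apply/negP => /prim_expr_order/eqP.
  by rewrite expr0n gtn_eqF // eq_sym oner_eq0.
have dlog_ex (x : 'F_p) : x != 0 -> exists i, g ^+ i == x.
  move=> x_neq0; have /(prim_rootP gP)[i ->] : x ^+ p.-1 = 1.
    by apply: (mulfI x_neq0); rewrite mulr1 -exprS prednK ?prime_gt0 ?expr_Fp.
  by exists i.
pose dlog (x : 'F_p) := if @idP (x != 0) is ReflectT h then ex_minn (dlog_ex x h) else 0%N.
have dlogE x : x != 0 -> g ^+ dlog x = x.
  by rewrite /dlog; case: {-}_ / idP => // h _; case: ex_minnP => m /eqP.
(* The discrete logarithm is additive only modulo p - 1, so identities are stated for powers of
   [z]. *)
have zdlog m x : g ^+ m = x -> z ^+ m = z ^+ dlog x.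
  move=> gm; apply/eqP; rewrite (eq_prim_root_expr zP) -(eq_prim_root_expr gP) dlogE ?gm //.
  by rewrite -gm expf_neq0.
pose chi (j : 'I_p.-1) x := if x == 0 then 0 else (z ^+ dlog x) ^+ j.
have chiE j x : x != 0 -> chi j x = (z ^+ dlog x) ^+ j by rewrite /chi => /negbTE->.
have dlog1 : z ^+ dlog 1 = 1 by rewrite -(zdlog 0) ?expr0.
exists chi, (Ordinal p1_gt0); split.
- move=> j x y; have [->|x0] := eqVneq x 0; first by rewrite /chi mul0r eqxx mul0r.
  have [->|y0] := eqVneq y 0; first by rewrite /chi mulr0 eqxx mulr0.
  rewrite !chiE ?mulf_neq0 // -exprMn -exprD; congr (_ ^+ _); apply/esym/zdlog.
  by rewrite exprD !dlogE.
- by move=> j; rewrite chiE ?oner_eq0 // dlog1 expr1n.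
- by move=> j; rewrite /chi eqxx.
- by move=> j x x0; rewrite chiE // -exprM (prim_root_norm _ zP).
- by move=> x x0; rewrite chiE // expr0.
- move=> j j_neq0; exists g => //; rewrite chiE // -(zdlog 1%N) // expr1.
  by rewrite -(prim_order_dvd zP) gtnNdvd // lt0n; apply: contra j_neq0 => /eqP j0; apply/eqP/val_inj.
move=> x x0; under eq_bigr => j _ do rewrite chiE // -exprM mulnC.
rewrite (prim_root_sum _ zP); congr (if _ then _ else _).
by rewrite (prim_order_dvd gP) dlogE.
Qed.

Lemma mc_conj p chi j0 : @mult_chars p chi j0 -> forall j x, x != 0 ->
  (chi j x)^* = chi j x^-1.
Proof.
move=> mc j x x0; have cx0 : chi j x != 0 by rewrite -normr_eq0 (mc_norm mc) ?oner_eq0.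
apply: (mulfI cx0); rewrite -normCK (mc_norm mc) // expr1n.
by rewrite -(mc_mul mc) mulfV // (mc_one mc).
Qed.

Record add_chars p (psi : 'F_p -> 'F_p -> algC) : Prop := AddChars {
  ac_add : forall t, {morph psi t : x y / x + y >-> x * y};
  ac_zero : forall t, psi t 0 = 1;
  ac_norm : forall t x, `|psi t x| = 1;
  ac_orth : forall x, \sum_t psi t x = if x == 0 then p%:R else 0
}.

Lemma add_chars_exist p : prime p -> exists psi, @add_chars p psi.
Proof.
move=> p_pr; have [z zP] := C_prim_root_exists (prime_gt0 p_pr).
pose e (x : 'F_p) := z ^+ (x : nat).
have e_nat n : e n%:R = z ^+ n by rewrite /e val_Fp_nat // (prim_expr_mod zP).
have nat_e (x : 'F_p) : (x : nat)%:R = x by apply: natr_Zp.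
have eD x y : e (x + y) = e x * e y.
  by rewrite -[x in LHS]nat_e -[y in LHS]nat_e -natrD e_nat exprD.
exists (fun t x => e (t * x)); split.
- by move=> t x y; rewrite mulrDr eD.
- by move=> t; rewrite mulr0 (e_nat 0%N) expr0.
- by move=> t x; rewrite (prim_root_norm _ zP).
have sum_Fp (f : nat -> algC) : \sum_(t : 'F_p) f t = \sum_(j < p) f j.
  by rewrite -(big_mkord xpredT f) -[RHS](big_mkord xpredT f) Fp_cast.
move=> x; transitivity (\sum_(j < p) z ^+ (j * (x : nat))).
  rewrite -(sum_Fp (fun j => z ^+ (j * (x : nat)))); apply: eq_bigr => t _.
  by rewrite -[t in LHS]nat_e -[x in LHS]nat_e -natrM e_nat.
rewrite (prim_root_sum _ zP); congr (if _ then _ else _).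
have := pchar_Fp p_pr => pc; rewrite -[in RHS](nat_e x).
by rewrite (dvdn_pcharf pc).
Qed.

Lemma ac_conj p psi : @add_chars p psi -> forall t x, (psi t x)^* = psi t (- x).
Proof.
move=> ac t x; have cx0 : psi t x != 0 by rewrite -normr_eq0 (ac_norm ac) oner_eq0.
apply: (mulfI cx0); rewrite -normCK (ac_norm ac) // expr1n.
by rewrite -(ac_add ac) subrr (ac_zero ac).
Qed.

(** Cauchy-Schwarz against the constant 1, from [2xy <= x^2 + y^2] summed over all pairs of
    indices. *)
Lemma norm_sum_sq (n : nat) (F : 'I_n -> algC) :
  `|\sum_(i < n) F i| ^+ 2 <= n%:R * \sum_(i < n) `|F i| ^+ 2.
Proof.
apply: le_trans (_ : (\sum_(i < n) `|F i|) ^+ 2 <= _).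
  by rewrite ler_pXn2r ?nnegrE ?sumr_ge0 ?ler_norm_sum.
have key (x y : algC) : 0 <= x -> 0 <= y -> 2 * (x * y) <= x ^+ 2 + y ^+ 2.
  move=> x0 y0; rewrite -subr_ge0 (_ : _ - _ = (x - y) ^+ 2); last by ring.
  by rewrite real_exprn_even_ge0 // rpredB ?ger0_real.
rewrite -(ler_pM2l (_ : 0 < 2)) // expr2 mulr_suml mulr_sumr.
under eq_bigr => i _ do rewrite mulr_sumr mulr_sumr.
apply: le_trans (_ : \sum_(i < n) \sum_(j < n) (`|F i| ^+ 2 + `|F j| ^+ 2) <= _).
  by apply: ler_sum => i _; apply: ler_sum => j _; apply: key.
under eq_bigr => i _ do rewrite big_split /= sumr_const card_ord.
by rewrite big_split /= sumr_const card_ord sumrMnl !mulr_natl mulr2n.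
Qed.

Lemma norm_add_sq (x y : algC) : `|x + y| ^+ 2 <= 2 * `|x| ^+ 2 + 2 * `|y| ^+ 2.
Proof.
have := @norm_sum_sq 2 (fun i => if i == 0 then x else y).
by rewrite !big_ord_recl !big_ord0 /= !addr0 mulrDr.
Qed.

(** * Character sums over factorials *)

Lemma natr_Fp_eq p (m n : nat) : prime p -> (m < p)%N -> (n < p)%N ->
  (m%:R == n%:R :> 'F_p) = (m == n).
Proof.
move=> p_pr lt_m lt_n; apply/eqP/eqP => [/(congr1 (@nat_of_ord _))|->//].
by rewrite !val_Fp_nat // !modn_small.
Qed.

Lemma natr_Fp_neq0 p m : prime p -> (0 < m < p)%N -> m%:R != 0 :> 'F_p.
Proof.
move=> p_pr /andP[m_gt0 lt_m]; rewrite -[0]/(0%:R) natr_Fp_eq //; last exact: prime_gt0.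
by rewrite -lt0n.
Qed.

Lemma sum_le_const n (F : 'I_n -> algC) B : (forall i, F i <= B) -> \sum_(i < n) F i <= n%:R * B.
Proof.
move=> hF; apply: (@le_trans _ _ (\sum_(i < n) B)); first exact: ler_sum.
by rewrite sumr_const card_ord mulr_natl.
Qed.

(** Each unit shift drops one term and gains one. *)
Lemma shifted_sum_bound (a : nat -> algC) N k : (forall i, `|a i| <= 1) ->
  `|\sum_(n < N) a n - \sum_(n < N) a (n + k)%N| <= (2 * k)%:R.
Proof.
move=> ha; elim: k => [|k IHk].
  rewrite [X in _ - X](eq_bigr (fun n : 'I_N => a n)) ?subrr ?normr0 // => n _.
  by rewrite addn0.
have E : \sum_(n < N) a (n + k.+1)%N = \sum_(n < N) a (n + k)%N + (a (N + k)%N - a k).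
  apply/eqP; rewrite addrA eq_sym subr_eq -[X in X == _](big_ord_recr _ (fun i => a (i + k)%N)).
  rewrite big_ord_recl add0n addrC; apply/eqP; congr (_ + _); apply: eq_bigr => i _.
  by rewrite lift0 addSnnS.
rewrite E opprD addrA mulnSr natrD; apply: le_trans (ler_normB _ _) _.
rewrite lerD //; apply: le_trans (ler_normB _ _) _.
exact: lerD (ha _) (ha _).
Qed.

(* The interval is covered by two windows of pairs (a, b), whose Fourier
   transforms are squared moduli. *)
Lemma window_cover p (G : 'F_p -> algC) (h : 'F_p) N : (forall x, 0 <= G x) ->
  N%:R * \sum_(n < N) G (h + n%:R) <=
  \sum_(a < N) \sum_(b < N) G (h + a%:R - b%:R) +
  \sum_(a < N) \sum_(b < N) G (h + N%:R + a%:R - b%:R).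
Proof.
move=> G_ge0; rewrite exchange_big [X in _ + X]exchange_big -big_split /=.
rewrite mulr_natl -[X in _ *+ X]card_ord -sumr_const; apply: ler_sum => b _.
pose f m := G (h + m%:R - b%:R).
have -> : \sum_(n < N) G (h + n%:R) = \sum_(b <= m < b + N) f m.
  rewrite -{1}[b : nat]add0n big_addn addKn big_mkord; apply: eq_bigr => n _.
  by rewrite /f natrD addrA addrK.
have -> : \sum_(a < N) G (h + a%:R - b%:R) = \sum_(0 <= m < N) f m by rewrite big_mkord.
have -> : \sum_(a < N) G (h + N%:R + a%:R - b%:R) = \sum_(N <= m < N + N) f m.
  rewrite -[X in \sum_(X <= _ < _) _]add0n big_addn addnK big_mkord; apply: eq_bigr => n _.
  by rewrite /f natrD addrA addrAC.
have b_lt := ltn_ord b.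
rewrite -big_cat_nat //=; last by rewrite leq_addr.
rewrite (@big_cat_nat _ _ _ b 0 (N + N)) //=; last by lia.
rewrite (@big_cat_nat _ _ _ (b + N) b (N + N)) //=; [|by lia|by lia].
by rewrite addrCA lerDl addr_ge0 // sumr_ge0 // => i _; apply: G_ge0.
Qed.

(** Fourier inversion weights the transform of [F] by [|A t| ^ 2] up to a phase. By Parseval these
    weights add up to [p * N], the elements b being distinct modulo p as [N <= p]; thus no logarithm
    is lost. *)
Lemma window_fourier p (psi : 'F_p -> 'F_p -> algC) (F : 'F_p -> algC) (c : 'F_p) N (B : algC) :
  prime p -> add_chars psi -> (N <= p)%N ->
  (forall t, `|\sum_x F x * psi t x| <= B) ->
  `|\sum_(a < N) \sum_(b < N) F (c + a%:R - b%:R)| <= N%:R * B.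
Proof.
move=> p_pr ac le_Np hB; have p_gt0 : 0 < p%:R :> algC by rewrite ltr0n prime_gt0.
pose A t := \sum_(b < N) psi t b%:R.
have parseval : \sum_t `|A t| ^+ 2 = (p * N)%:R.
  rewrite (eq_bigr (fun t => \sum_(b < N) \sum_(b' < N) psi t (b%:R - b'%:R))) => [|t _].
    rewrite exchange_big /= (eq_bigr (fun=> p%:R)) => [|b _].
      by rewrite sumr_const card_ord natrM mulr_natr.
    rewrite exchange_big /= (bigD1 b) //= (ac_orth ac) subrr eqxx big1 ?addr0 // => b' b'b.
    rewrite (ac_orth ac) subr_eq0 natr_Fp_eq ?(leq_trans (ltn_ord _)) // eq_sym.
    by rewrite val_eqE (negbTE b'b).
  rewrite normCK rmorph_sum mulr_suml; apply: eq_bigr => b _.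
  by rewrite mulr_sumr; apply: eq_bigr => b' _ /=; rewrite (ac_conj ac) (ac_add ac).
have key : p%:R * \sum_(a < N) \sum_(b < N) F (c + a%:R - b%:R) =
    \sum_t (\sum_x F x * psi t x) * (psi t (- c) * ((A t)^* * A t)).
  have Finv y : p%:R * F y = \sum_t \sum_x F x * psi t x * psi t (- y).
    rewrite exchange_big /= (bigD1 y) //= [X in _ + X]big1 => [|x xy].
      rewrite addr0 mulrC -[p%:R](_ : \sum_t psi t (y - y) = _).
        by rewrite mulr_sumr; apply: eq_bigr => t _; rewrite -mulrA -(ac_add ac).
      by rewrite (ac_orth ac) subrr eqxx.
    under eq_bigr => t _ do rewrite -mulrA -(ac_add ac).
    by rewrite -mulr_sumr (ac_orth ac) subr_eq0 (negbTE xy) mulr0.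
  rewrite mulr_sumr.
  under eq_bigr => a _ do rewrite mulr_sumr.
  under eq_bigr => a _ do under eq_bigr => b _ do rewrite Finv.
  under eq_bigr => a _ do rewrite exchange_big /=.
  rewrite exchange_big /=; apply: eq_bigr => t _.
  set Fh := \sum_x F x * psi t x.
  transitivity (\sum_(a < N) \sum_(b < N) Fh * psi t (- (c + a%:R - b%:R))).
    by apply: eq_bigr => a _; apply: eq_bigr => b _; rewrite mulr_suml.
  move: Fh => Fh; rewrite rmorph_sum mulr_suml !mulr_sumr; apply: eq_bigr => a _ /=.
  rewrite !mulr_sumr; apply: eq_bigr => b _; congr (_ * _).
  by rewrite (ac_conj ac) -!(ac_add ac) !opprD opprK addrA.
rewrite -(ler_pM2l p_gt0) -{1}(normr_nat _ p) -normrM key.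
apply: le_trans (ler_norm_sum _ _ _) _.
apply: le_trans (_ : \sum_t B * `|A t| ^+ 2 <= _).
  apply: ler_sum => t _; rewrite !normrM (ac_norm ac) mul1r norm_conjC -expr2.
  by rewrite ler_wpM2r ?exprn_ge0.
by rewrite -mulr_sumr parseval natrM mulrC mulrA.
Qed.

Section FactorialSum.
Variables (p : nat) (chi : 'I_p.-1 -> 'F_p -> algC) (j0 : 'I_p.-1) (psi : 'F_p -> 'F_p -> algC).
Hypotheses (p_pr : prime p) (p_gt2 : (2 < p)%N) (mc : mult_chars chi j0) (ac : add_chars psi).

Definition facF (n : nat) : 'F_p := (n`!)%:R.

Lemma facF_neq0 n : (n < p)%N -> facF n != 0.
Proof.
elim: n => [|n IHn] lt_np; first by rewrite /facF oner_eq0.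
by rewrite /facF factS natrM mulf_neq0 ?IHn ?natr_Fp_neq0 // ltnW.
Qed.

Lemma chi_le1 j x : `|chi j x| <= 1.
Proof.
by have [->|/(mc_norm mc)->//] := eqVneq x 0; rewrite (mc_zero mc) normr0.
Qed.

(** At [x = n] this is [(n + k)! / (n + m)!]; the lower index makes quotients of such products again
    of this form. *)
Definition shift_prod (m k : nat) (x : 'F_p) : 'F_p := \prod_(m <= i < k) (i.+1%:R + x).

Lemma facF_shift n k : facF (n + k) = facF n * shift_prod 0 k n%:R.
Proof.
elim: k => [|k IHk]; first by rewrite addn0 /shift_prod big_geq ?mulr1.
rewrite addnS /facF factS natrM -/(facF (n + k)) IHk mulrCA /shift_prod big_nat_recr //=.
by congr (_ * _); rewrite mulrC -natrD addSn addnC.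
Qed.

(** Wider than the family [psi], so that it is visibly closed under conjugation, which exchanges the
    two shifts. *)
Definition is_add_char (ps : 'F_p -> algC) :=
  [/\ {morph ps : x y / x + y >-> x * y}, ps 0 = 1 & forall x, `|ps x| = 1].

Lemma is_add_char_psi t : is_add_char (psi t).
Proof. by split; [apply: ac_add|apply: ac_zero|apply: ac_norm]. Qed.

Lemma is_add_char_conj ps : is_add_char ps -> is_add_char (fun x => (ps x)^*).
Proof.
by move=> [psD ps0 psN]; split=> [x y||x]; rewrite ?psD ?rmorphM ?ps0 ?rmorph1 ?norm_conjC.
Qed.

(** The substitution of [-x] for [x] brings the factors to the form [a - x]; the points [a] are
    distinct since [k < p]. *)
Lemma shift_prod_weil j ps m k : is_add_char ps -> j != j0 -> (m < k < p)%N ->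
  `|\sum_x chi j (shift_prod m k x) * ps x| <= (k - m)%:R * sqrtC p%:R.
Proof.
move=> [psD ps0 psN] jj0 /andP[lt_mk lt_kp].
pose al : seq 'F_p := [seq i.+1%:R | i <- index_iota m k].
have sz_al : size al = (k - m)%N by rewrite size_map size_iota.
have al_uniq : uniq al.
  rewrite map_inj_in_uniq ?iota_uniq // => i i'; rewrite !mem_index_iota => hi hi' /eqP.
  by rewrite natr_Fp_eq //; [move=> /eqP[]|lia|lia].
rewrite -sz_al; have := @weil_bound algC p (chi j) (fun x => ps (- x)) al p_pr p_gt2
  (mc_mul mc j) (mc_one mc j) (mc_zero mc j) (mc_nontriv mc jj0).
have -> : \sum_x chi j (shift_prod m k x) * ps x =
    \sum_x chi j (\prod_(a <- al) (a - x)) * ps (- x).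
  rewrite (reindex_inj (@oppr_inj _)) /=; apply: eq_bigr => x _.
  by congr (chi j _ * _); rewrite /shift_prod big_map.
apply=> //.
- by move=> x y; rewrite opprD psD.
- by rewrite oppr0 ps0.
- exact: chi_le1.
- by move=> x; rewrite psN.
- by rewrite sz_al subn_gt0.
Qed.

Lemma shift_prod_eq0 m x : shift_prod 0 m x = 0 -> x \in [seq - (i.+1%:R) : 'F_p | i <- iota 0 m].
Proof.
move/eqP; rewrite /shift_prod prodf_seq_eq0 /index_iota subn0 => /hasP[i im /=].
by rewrite addrC addr_eq0 => /eqP->; apply: map_f.
Qed.

(** The product of the two values is [chi j (shift_prod m k x)] except at the at most [m] zeros of
    [shift_prod 0 m], where it is 0. The integer [q] stands for the square root of p, and
    [(k - m) * q + m <= K * q]. *)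
Lemma shift_pair_fourier j ps (K q k m : nat) : is_add_char ps -> j != j0 -> (K <= p)%N -> (0 < q)%N -> (p <= q ^ 2)%N ->
  (m < k < K)%N ->
  `|\sum_x chi j (shift_prod 0 k x) * (chi j (shift_prod 0 m x))^* * ps x| <= (K * q)%:R.
Proof.
move=> ps_char jj0 le_Kp q_gt0 le_pq /andP[lt_mk lt_kK].
have sqrt_le : sqrtC p%:R <= q%:R :> algC.
  by rewrite -(ler_pXn2r (_ : 0 < 2)%N) ?nnegrE ?sqrtC_ge0 ?ler0n // sqrtCK -natrX ler_nat.
have split_prod x : shift_prod 0 k x = shift_prod 0 m x * shift_prod m k x.
  by rewrite /shift_prod -big_cat_nat //= ltnW.
have bound0 : `|\sum_x chi j (shift_prod m k x) * ps x| <= (k - m)%:R * q%:R.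
  apply: le_trans (shift_prod_weil ps_char jj0 _) _; first by lia.
  by rewrite ler_wpM2l ?ler0n.
have -> : \sum_x chi j (shift_prod 0 k x) * (chi j (shift_prod 0 m x))^* * ps x =
   \sum_x chi j (shift_prod m k x) * ps x -
   \sum_(x | shift_prod 0 m x == 0) chi j (shift_prod m k x) * ps x.
  rewrite [X in X - _](bigID (fun x => shift_prod 0 m x == 0)) /= addrAC subrr add0r.
  rewrite (bigID (fun x => shift_prod 0 m x == 0)) /= big1 ?add0r => [|x /eqP->]; last first.
    by rewrite (mc_zero mc) rmorph0 mulr0 mul0r.
  apply: eq_bigr => x x0; rewrite split_prod (mc_mul mc) [X in X * ps x](_ : _ = chi j (shift_prod m k x)) //.
  by rewrite mulrAC -normCK (mc_norm mc) // expr1n mul1r.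
apply: le_trans (ler_normB _ _) _; apply: le_trans (lerD bound0 (_ : _ <= m%:R)) _; last first.
  by rewrite -natrM -natrD ler_nat; nia.
apply: le_trans (ler_norm_sum _ _ _) _.
apply: le_trans (_ : \sum_(x | shift_prod 0 m x == 0) 1 <= _).
  by apply: ler_sum => x _; rewrite normrM (let: And3 _ _ psN := ps_char in psN) mulr1 chi_le1.
rewrite sumr_const ler_nat -{2}(size_iota 0 m) -(size_map (fun i => - (i.+1%:R) : 'F_p)).
rewrite cardE; apply: uniq_leq_size; first exact: enum_uniq.
by move=> x; rewrite mem_enum => hx; apply/shift_prod_eq0/eqP.
Qed.

Variables (H N : nat).
Hypotheses (N_gt0 : (0 < N)%N) (HNp : (H + N < p)%N).

Definition facsum j : algC := \sum_(n < N) chi j (facF (H + 1 + n)).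

Let G j K x := \sum_(k < K) chi j (shift_prod 0 k x).

(** After expanding the square, each of the [K] diagonal pairs costs at most [N ^ 2], and each of
    the fewer than [K ^ 2] others at most [N * K * q] by [window_fourier]. *)
Lemma window_bound j (K q : nat) c : j != j0 -> (K <= p)%N -> (0 < q)%N -> (p <= q ^ 2)%N ->
  \sum_(a < N) \sum_(b < N) `|G j K (c + a%:R - b%:R)| ^+ 2 <= (K * N ^ 2 + K ^ 3 * N * q)%:R.
Proof.
move=> jj0 le_Kp q_gt0 le_pq.
pose F k m x := chi j (shift_prod 0 k x) * (chi j (shift_prod 0 m x))^*.
have EF : \sum_(a < N) \sum_(b < N) `|G j K (c + a%:R - b%:R)| ^+ 2 =
    \sum_(k < K) \sum_(m < K) \sum_(a < N) \sum_(b < N) F k m (c + a%:R - b%:R).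
  under [RHS]eq_bigr => k _ do rewrite exchange_big /=.
  rewrite [RHS]exchange_big /=; apply: eq_bigr => a _.
  under [RHS]eq_bigr => k _ do rewrite exchange_big /=.
  rewrite [RHS]exchange_big /=; apply: eq_bigr => b _.
  rewrite normCK rmorph_sum mulr_suml; apply: eq_bigr => k _.
  by rewrite mulr_sumr.
have Foff k m : (k < K)%N -> (m < K)%N -> k != m ->
    `|\sum_(a < N) \sum_(b < N) F k m (c + a%:R - b%:R)| <= (N * (K * q))%:R.
  move=> hk hm km; rewrite natrM; apply: (window_fourier _ p_pr ac); first by lia.
  move=> t; move: km; rewrite neq_ltn => /orP[lt_km|lt_mk]; last first.
    by apply: shift_pair_fourier => //; [apply: is_add_char_psi|rewrite lt_mk].
  rewrite -norm_conjC rmorph_sum /=.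
  have := @shift_pair_fourier j _ K q m k (is_add_char_conj (is_add_char_psi t)) jj0 le_Kp q_gt0 le_pq.
  rewrite lt_km hm => /(_ isT); congr (`|_| <= _); apply: eq_bigr => x _.
  by rewrite !rmorphM /= conjCK [X in X * _]mulrC.
have Fon k : `|\sum_(a < N) \sum_(b < N) F k k (c + a%:R - b%:R)| <= (N * N)%:R.
  rewrite natrM; apply: le_trans (ler_norm_sum _ _ _) _; apply: sum_le_const => a.
  rewrite -[N%:R]mulr1; apply: le_trans (ler_norm_sum _ _ _) _; apply: sum_le_const => b.
  by rewrite /F normrM norm_conjC mulr_ile1 ?chi_le1.
have ge0 : 0 <= \sum_(a < N) \sum_(b < N) `|G j K (c + a%:R - b%:R)| ^+ 2.
  by apply: sumr_ge0 => a _; apply: sumr_ge0 => b _; apply: exprn_ge0.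
rewrite -(ger0_norm ge0) EF.
apply: le_trans (ler_norm_sum _ _ _) _.
have -> : (K * N ^ 2 + K ^ 3 * N * q = K * (N * N + K * (N * (K * q))))%N by nia.
rewrite natrM; apply: sum_le_const => k; apply: le_trans (ler_norm_sum _ _ _) _.
rewrite (bigD1 k) //= natrD lerD ?Fon // natrM.
apply: le_trans (_ : \sum_(m < K) (N * (K * q))%:R <= _); last exact: sum_le_const.
rewrite [leRHS](bigD1 k) //= ler_wpDl //; apply: ler_sum => m mk.
by rewrite Foff // eq_sym.
Qed.


(** Averaging over the translates by [k < K]: each costs at most [2 * k], and [(n + k)!] splits off
    [n!]. *)
Lemma facsum_shift j (K : nat) :
  `|K%:R * facsum j - \sum_(n < N) chi j (facF (H + 1 + n)) * G j K (H + 1 + n)%:R| <= (K ^ 2)%:R.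
Proof.
have -> : K%:R * facsum j - \sum_(n < N) chi j (facF (H + 1 + n)) * G j K (H + 1 + n)%:R =
   \sum_(k < K) (facsum j - \sum_(n < N) chi j (facF (H + 1 + (n + k)))).
  rewrite sumrB sumr_const card_ord mulr_natl; congr (_ - _).
  rewrite exchange_big /=; apply: eq_bigr => n _; rewrite mulr_sumr; apply: eq_bigr => k _.
  by rewrite -(mc_mul mc) (addnA (H + 1)%N) (facF_shift (H + 1 + n)).
apply: le_trans (ler_norm_sum _ _ _) _.
apply: le_trans (_ : \sum_(k < K) (2 * k)%:R <= _).
  apply: ler_sum => k _.
  exact: (@shifted_sum_bound (fun n => chi j (facF (H + 1 + n)))) (fun n => chi_le1 _ _).
rewrite -natr_sum ler_nat -big_distrr /= -(big_mkord xpredT id) /=.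
elim: (K) => [|k IHk]; first by rewrite big_geq.
by rewrite big_nat_recr //= mulnDr; move: IHk; nia.
Qed.

(** [K * facsum j] differs from [V] by at most [K ^ 2]. Cauchy-Schwarz removes the factors at
    factorials from [V], and two windows cover the interval of the remaining sum; one factor [K] is
    then cancelled. *)
Theorem facsum_bound j (K q : nat) : j != j0 -> (0 < K <= p)%N -> (0 < q)%N -> (p <= q ^ 2)%N ->
  K%:R * `|facsum j| ^+ 2 <= (2 * K ^ 3 + 4 * N ^ 2 + 4 * K ^ 2 * N * q)%:R.
Proof.
move=> jj0 /andP[K_gt0 le_Kp] q_gt0 le_pq.
have N_gt0' : 0 < N%:R :> algC by rewrite ltr0n.
set V := \sum_(n < N) chi j (facF (H + 1 + n)) * G j K (H + 1 + n)%:R.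
have V_le : `|V| ^+ 2 <= (2 * (K * N ^ 2 + K ^ 3 * N * q))%:R.
  apply: le_trans (norm_sum_sq _) _.
  apply: le_trans (_ : N%:R * \sum_(n < N) `|G j K ((H + 1)%:R + n%:R)| ^+ 2 <= _).
    rewrite ler_pM2l //; apply: ler_sum => n _; rewrite -natrD normrM exprMn.
    by rewrite ler_piMl ?exprn_ge0 // exprn_ile1 // chi_le1.
  apply: le_trans (@window_cover p (fun x => `|G j K x| ^+ 2) _ _ _) _.
    by move=> x; rewrite exprn_ge0.
  by rewrite mul2n -addnn [leRHS]natrD lerD // window_bound.
have := norm_add_sq (K%:R * facsum j - V) V; rewrite subrK normrM normr_nat exprMn => h.
rewrite -(ler_pM2l (_ : 0 < K%:R)) ?ltr0n // mulrA -expr2; apply: le_trans h _.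
apply: le_trans (_ : 2 * (K ^ 2)%:R ^+ 2 + 2 * (2 * (K * N ^ 2 + K ^ 3 * N * q))%:R <= _).
  by rewrite lerD // ler_pM2l // ler_pXn2r ?nnegrE ?ler0n // facsum_shift.
by rewrite -natrX -!natrM -natrD ler_nat; apply/eq_leq; ring.
Qed.

End FactorialSum.

(** * Moments and the number of solutions *)

Lemma natr_Fp_eqmod p (a b : nat) : prime p -> (a%:R == b%:R :> 'F_p) = (a == b %[mod p]).
Proof. by move=> p_pr; rewrite -val_eqE /= !val_Fp_nat. Qed.

Section Moments.
Variables (p : nat) (chi : 'I_p.-1 -> 'F_p -> algC) (j0 : 'I_p.-1).
Hypotheses (p_pr : prime p) (mc : mult_chars chi j0).
Variables (H N : nat).
Hypotheses (HNp : (H + N < p)%N).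
Local Notation S := (facsum chi H N).

Let f (n : nat) : 'F_p := facF p (H + 1 + n).

Let f_neq0 (n : 'I_N) : f n != 0.
Proof. by apply: facF_neq0 => //; have := ltn_ord n; lia. Qed.

Let p1_gt0 : (0 < p.-1)%N.
Proof. by rewrite -subn1 subn_gt0 prime_gt1. Qed.

Lemma facsum_trivial : S j0 = N%:R.
Proof.
rewrite /facsum (eq_bigr (fun=> 1)) ?sumr_const ?card_ord // => n _.
by rewrite (mc_triv mc) // f_neq0.
Qed.

Lemma facsum_le j : `|S j| ^+ 2 <= (N ^ 2)%:R.
Proof.
rewrite natrX ler_pXn2r ?nnegrE ?ler0n //; apply: le_trans (ler_norm_sum _ _ _) _.
rewrite -[N%:R]mulr1; apply: sum_le_const => n; exact: (chi_le1 mc).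
Qed.

(** The list consists of products of [l] quotients of factorials. It is the same for all [j], so
    orthogonality can act on it later. *)
Lemma facsum_pow_list l : exists s : seq 'F_p,
  [/\ forall x, x \in s -> x != 0, size s = (N ^ (2 * l))%N &
      forall j, `|S j| ^+ (2 * l) = \sum_(x <- s) chi j x].
Proof.
elim: l => [|l [s [s0 sz_s sE]]].
  exists [:: 1]; split=> [x||j]; first by rewrite inE => /eqP->; rewrite oner_eq0.
    by rewrite muln0 expn0.
  by rewrite muln0 expr0 big_seq1 (mc_one mc).
pose t := [seq f n / f m | n : 'I_N <- enum 'I_N, m : 'I_N <- enum 'I_N].
have t0 y : y \in t -> y != 0.
  by move=> /allpairsP[[n m] /= [_ _ ->]]; rewrite mulf_neq0 ?invr_eq0 ?f_neq0.
exists [seq x * y | x <- s, y <- t]; split.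
- by move=> _ /allpairsP[[x y] /= [xs yt ->]]; rewrite mulf_neq0 ?(s0 _ xs) ?(t0 _ yt).
- by rewrite !size_allpairs sz_s size_enum_ord mulnS expnD mulnC expnS expn1.
move=> j; rewrite mulnS addnC exprD sE big_allpairs_dep mulr_suml; apply: eq_bigr => x _.
under eq_bigr => y _ do rewrite (mc_mul mc).
rewrite -mulr_sumr; congr (_ * _); rewrite big_allpairs_dep normCK rmorph_sum mulr_suml big_enum.
apply: eq_bigr => n _; rewrite mulr_sumr big_enum; apply: eq_bigr => m _.
by rewrite /= (mc_conj mc) ?f_neq0 // -(mc_mul mc).
Qed.

Definition moment l := \sum_j `|S j| ^+ (2 * l).

Lemma sum_chars_list (s : seq 'F_p) : (forall x, x \in s -> x != 0) ->
  \sum_j \sum_(x <- s) chi j x = p.-1%:R * (count_mem 1 s)%:R.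
Proof.
move=> s0; rewrite exchange_big /= -sum1_count natr_sum mulr_sumr [RHS]big_mkcond /=.
by apply: eq_big_seq => x xs; rewrite (mc_orth mc) ?s0 //; case: eqP; rewrite ?mulr1.
Qed.

(** A polynomial of degree [k] is being solved at points distinct modulo p. *)
Let shift_root_count (x : 'F_p) k : (0 < k)%N ->
  (\sum_(n < N) (shift_prod 0 k (H + 1 + n)%:R == x) <= k)%N.
Proof.
move=> k_gt0; pose P : {poly 'F_p} := \prod_(0 <= i < k) ('X - (- i.+1%:R)%:P) - x%:P.
have szP : size P = k.+1.
  rewrite /P size_polyDl size_prod_XsubC size_iota subn0 //.
  by rewrite size_polyN ltnS (leq_trans (size_polyC_leq1 _)).
have -> : (\sum_(n < N) (shift_prod 0 k (H + 1 + n)%:R == x) =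
    size [seq n : 'I_N <- enum 'I_N | shift_prod 0 k (H + 1 + n)%:R == x])%N.
  rewrite size_filter -sum1_count big_enum_cond /= [RHS]big_mkcond.
  by apply: eq_bigr => n _; case: eqP.
rewrite -ltnS -szP -(size_map (fun n : 'I_N => (H + 1 + n)%:R : 'F_p)).
apply: max_poly_roots.
- by rewrite -size_poly_eq0 szP.
- apply/allP => y /mapP[n]; rewrite mem_filter => /andP[/eqP nx _] ->.
  rewrite rootE /P hornerD hornerN hornerC horner_prod subr_eq0 -nx; apply/eqP.
  by apply: eq_bigr => i _; rewrite hornerXsubC opprK addrC.
rewrite map_inj_in_uniq; first exact/filter_uniq/enum_uniq.
move=> n m _ _ /eqP.
have := ltn_ord n; have := ltn_ord m => hm hn.
by rewrite natr_Fp_eq //; [rewrite eqn_add2l => /eqP/val_inj|lia|lia].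
Qed.

Let close_pairs_lt (x : 'F_p) K : x != 0 ->
  (\sum_(n < N) \sum_(m < N) ((n < m < n + K) && (x * f n == f m)%R) <= K ^ 2)%N.
Proof.
move=> x0.
apply: leq_trans (_ : \sum_(n < N) \sum_(m < N) \sum_(k < K | (0 < k)%N)
    ((m == n + k :> nat) && (x * f n == f (n + k)%N)%R) <= _)%N.
  apply: leq_sum => n _; apply: leq_sum => m _.
  case: andP => // -[/andP[lt_nm lt_mK] E]; have lt_k : (m - n < K)%N by lia.
  rewrite (bigD1 (Ordinal lt_k)) /= ?subn_gt0 // subnKC ?(ltnW lt_nm) // eqxx.
  by rewrite E.
under eq_bigr => n _ do rewrite exchange_big /=.
rewrite exchange_big /= -mulnn -[X in (_ <= X * _)%N]card_ord -sum_nat_const big_mkcond /=.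
apply: leq_sum => k _; case: ifP => // k_gt0; apply: leq_trans (ltnW (ltn_ord k)).
apply: leq_trans (shift_root_count x k_gt0); apply: leq_sum => n _.
have -> : (x * f n == f (n + k)%N) = (shift_prod 0 k (H + 1 + n)%:R == x).
  rewrite {2}/f (addnA (H + 1)%N) (facF_shift p (H + 1 + n)) [x * _]mulrC.
  by rewrite (inj_eq (mulfI (f_neq0 n))) eq_sym.
case: eqP => _; last by rewrite big1 // => m _; rewrite andbF.
have [lt_nk|le_nk] := ltnP (n + k) N.
  rewrite (bigD1 (Ordinal lt_nk)) //= eqxx big1 // => m; rewrite -val_eqE /= => /negbTE->.
  by [].
by rewrite big1 // => m _; rewrite ltn_eqF // (leq_trans (ltn_ord m)).
Qed.

(** The diagonal contributes only for [x = 1]. Pairs in one block of length [K] differ by less than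
    [K], and those with [m < n] are reversed by passing to the inverse of [x]. *)
Let close_pairs (x : 'F_p) K : x != 0 -> (0 < K)%N ->
  (\sum_(n < N) \sum_(m < N | m %/ K == n %/ K) (x * f n == f m)%R <= N * (x == 1%R) + 2 * K ^ 2)%N.
Proof.
move=> x0 K_gt0; have xi0 : x^-1 != 0 by rewrite invr_eq0.
have h1 := close_pairs_lt K x0; have h2 := close_pairs_lt K xi0.
apply: leq_trans (_ : N * (x == 1%R) + (K ^ 2 + K ^ 2) <= _)%N; last by lia.
apply: leq_trans (leq_add (leqnn (N * (x == 1%R))) (leq_add h1 h2)).
rewrite [X in (_ <= _ + (_ + X))%N]exchange_big /= -[X in (_ <= X * _ + _)%N]card_ord.
rewrite -sum_nat_const -!big_split /=; apply: leq_sum => n _.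
rewrite big_mkcond -big_split /=.
have -> : ((x == 1%R) = \sum_(m < N) ((m == n) && (x * f n == f m)%R) :> nat)%N.
  rewrite (bigD1 n) //= eqxx big1 ?addn0 /= => [|m /negbTE->//].
  by rewrite -[X in (_ * f n == X)]mul1r (inj_eq (mulIf (f_neq0 n))).
rewrite -big_split /=; apply: leq_sum => m _; case: ifP => // /eqP E.
have := divn_eq n K; have := divn_eq m K; have := ltn_pmod n K_gt0; have := ltn_pmod m K_gt0.
rewrite E; move: (n %/ K * K)%N (n %% K)%N (m %% K)%N => c rn rm hm hn Em En.
have -> : (x^-1 * f m == f n) = (x * f n == f m).
  by rewrite -(inj_eq (mulfI x0)) mulrA mulfV // mul1r eq_sym.
case: (x * f n == f m); rewrite // !andbT.
have [lt|lt|/val_inj->] := ltngtP (n : nat) m; last by rewrite eqxx.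
  by rewrite (_ : (m < n + K)%N) ?addnS //; lia.
by rewrite (_ : (n < m + K)%N) ?addnS //; lia.
Qed.

(** Cauchy-Schwarz over the [N %/ K + 1] blocks replaces one factor [|S j| ^ 2] by the sum [T j]
    over pairs in a common block. Orthogonality turns the result into a count for [close_pairs]: its
    diagonal gives [N * moment l], the rest [2 * K ^ 2] for each of the [N ^ (2 * l)] list
    elements. *)
Lemma moment_rec l K : (0 < K)%N -> moment l.+1 <=
  (N %/ K).+1%:R * (N%:R * moment l + (p.-1 * (2 * K ^ 2 * N ^ (2 * l)))%:R).
Proof.
move=> K_gt0; have [s [s0 sz_s sE]] := facsum_pow_list l.
pose g (n : 'I_N) : 'I_(N %/ K).+1 := inord (n %/ K)%N.
have gE n m : (g m == g n) = (m %/ K == n %/ K)%N.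
  by rewrite -val_eqE /= !inordK // ltnS leq_div2r // ltnW.
pose T j := \sum_(n < N) \sum_(m < N | (m %/ K == n %/ K)%N) chi j (f n / f m).
have TE j : `|S j| ^+ 2 <= (N %/ K).+1%:R * T j.
  rewrite /facsum (partition_big g xpredT) //=; apply: le_trans (norm_sum_sq _) _.
  rewrite ler_pM2l ?ltr0n // /T [in leRHS](partition_big g xpredT) //=.
  rewrite le_eqVlt; apply/orP; left; apply/eqP; apply: eq_bigr => b _.
  rewrite normCK rmorph_sum mulr_suml; apply: eq_bigr => n /eqP <-.
  rewrite mulr_sumr; apply: eq_big => [m|m _]; first by rewrite gE.
  by rewrite /= (mc_conj mc) ?f_neq0 // -(mc_mul mc).
apply: le_trans (_ : (N %/ K).+1%:R * \sum_j `|S j| ^+ (2 * l) * T j <= _).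
  rewrite mulr_sumr /moment; apply: ler_sum => j _; rewrite mulnSr exprD [leRHS]mulrCA.
  by rewrite ler_wpM2l ?exprn_ge0.
rewrite ler_pM2l ?ltr0n //.
have -> : \sum_j `|S j| ^+ (2 * l) * T j =
   p.-1%:R * (\sum_(x <- s) \sum_(n < N) \sum_(m < N | (m %/ K == n %/ K)%N) (x * f n == f m)%R)%:R.
  rewrite (eq_bigr (fun j => \sum_(x <- s) chi j x * T j)) => [|j _]; last first.
    by rewrite sE mulr_suml.
  rewrite exchange_big /= natr_sum mulr_sumr; apply: eq_big_seq => x xs.
  under eq_bigr => j _ do rewrite mulr_sumr.
  rewrite exchange_big /= natr_sum mulr_sumr; apply: eq_bigr => n _.
  under eq_bigr => j _ do rewrite mulr_sumr.
  rewrite exchange_big /= natr_sum mulr_sumr; apply: eq_bigr => m _.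
  under eq_bigr => j _ do rewrite -(mc_mul mc) mulrA.
  rewrite (mc_orth mc); last by rewrite !mulf_neq0 ?invr_eq0 ?f_neq0 ?s0.
  by rewrite -subr_eq0 -{1}(divff (f_neq0 m)) -mulrBl mulf_eq0 invr_eq0 (negbTE (f_neq0 m))
    orbF subr_eq0; case: eqP; rewrite ?mulr1 ?mulr0.
have -> : N%:R * moment l = p.-1%:R * (N * count_mem 1 s)%:R.
  by rewrite /moment; under eq_bigr => j _ do rewrite sE; rewrite sum_chars_list // natrM mulrCA.
rewrite [(p.-1 * _)%:R]natrM -mulrDr -natrD ler_pM2l ?ltr0n // ler_nat -sz_s.
apply: leq_trans (_ : \sum_(x <- s) (N * (x == 1%R) + 2 * K ^ 2) <= _)%N.
  by rewrite big_seq [leqRHS]big_seq; apply: leq_sum => x xs; rewrite close_pairs ?s0.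
rewrite big_split /= -big_distrr /= big_const_seq count_predT iter_addn_0.
by rewrite leq_add2r -sum1_count [in leqRHS]big_mkcond.
Qed.

(** Expanding the power over all tuples, conjugated factors carrying the second half, leaves
    [chi j (A / B)], and summing over [j] detects [A = B]. *)
Lemma moment_I_count l : moment l = p.-1%:R * (I_count l p H N)%:R.
Proof.
pose Q (n : 'I_(H + N).+1) := (H + 1 <= n <= H + N)%N.
pose c j (i : 'I_(2 * l)) (n : 'I_(H + N).+1) : algC :=
  if (i < l)%N then chi j (facF p n) else (chi j (facF p n))^*.
have fac0 (n : 'I_(H + N).+1) : facF p n != 0.
  by apply: facF_neq0 => //; have := ltn_ord n; lia.
have SE j : \sum_(n | Q n) chi j (facF p n) = S j.
  transitivity (\sum_(H + 1 <= n < (H + N).+1) chi j (facF p n)).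
    rewrite (big_nat_widenl _ 0%N) //= big_mkord; apply: eq_bigl => n; rewrite /Q.
    by have := ltn_ord n; lia.
  rewrite -{1}[(H + 1)%N]add0n big_addn.
  have -> : ((H + N).+1 - (H + 1) = N)%N by lia.
  by rewrite big_mkord; apply: eq_bigr => n _; rewrite addnC.
rewrite /I_count -sum1_card natr_sum mulr_sumr.
transitivity (\sum_(n in family (fun=> Q)) \sum_j \prod_(i < 2 * l) c j i (n i)).
  rewrite exchange_big /=; apply: eq_bigr => j _.
  rewrite -(bigA_distr_big_dep _ (c j)) /=.
  rewrite (eq_bigr (fun i : 'I_(2 * l) => if (i < l)%N then S j else (S j)^*)) => [|i _].
    rewrite -(big_mkord xpredT (fun i => if (i < l)%N then S j else (S j)^*)).
    rewrite (big_cat_nat (n := l)) //=; last by lia.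
    rewrite (@eq_big_nat _ _ _ _ _ _ (fun=> S j)) => [|i /andP[_ ->]//].
    rewrite [X in _ * X](@eq_big_nat _ _ _ _ _ _ (fun=> (S j)^*)) => [|i /andP[le_li _]]; last first.
      by rewrite ltnNge le_li.
    rewrite !prodr_const_nat subn0 (_ : (2 * l - l)%N = l); last by lia.
    by rewrite exprM normCK exprMn.
  by rewrite /c; case: ifP => _; rewrite -SE // rmorph_sum.
rewrite [RHS](eq_bigl (fun n : {ffun 'I_(2 * l) -> 'I_(H + N).+1} =>
   (n \in family (fun=> Q)) && (\prod_(i < 2 * l | i < l) (n i)`! ==
     \prod_(i < 2 * l | l <= i) (n i)`! %[mod p])%N)); last first.
  by move=> n; rewrite inE; congr (_ && _); apply/forallP/familyP.
rewrite [RHS]big_mkcondr; apply: eq_bigr => n _.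
pose A : 'F_p := \prod_(i < 2 * l | (i < l)%N) facF p (n i).
pose B : 'F_p := \prod_(i < 2 * l | (l <= i)%N) facF p (n i).
have A0 : A != 0 by apply/prodf_neq0.
have B0 : B != 0 by apply/prodf_neq0.
rewrite (eq_bigr (fun j => chi j (A / B))) => [|j _]; last first.
  rewrite (mc_mul mc) -(mc_conj mc) // (big_morph (chi j) (mc_mul mc j) (mc_one mc j)).
  rewrite (big_morph (chi j) (mc_mul mc j) (mc_one mc j)) rmorph_prod.
  rewrite (bigID (fun i : 'I_(2 * l) => (i < l)%N)) /=; congr (_ * _).
    by apply: eq_bigr => i il; rewrite /c il.
  by apply: eq_big => [i|i /negbTE il]; [rewrite -leqNgt|rewrite /c il].
rewrite (mc_orth mc) ?mulf_neq0 ?invr_eq0 // -(inj_eq (mulIf B0)) mulfVK // mul1r mulr1.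
by rewrite /A /B /facF -!natr_prod natr_Fp_eqmod.
Qed.


Lemma I_count_rec l K : (0 < K)%N ->
  (I_count l.+1 p H N <= (N %/ K).+1 * (N * I_count l p H N + 2 * K ^ 2 * N ^ (2 * l)))%N.
Proof.
move=> K_gt0; have := moment_rec l K_gt0; rewrite !moment_I_count.
rewrite mulrCA natrM -mulrDr mulrCA ler_pM2l ?ltr0n //.
by rewrite -!(natrM, natrD) ler_nat.
Qed.

(** The trivial character contributes [N ^ (2 * l)]. The others contribute a nonnegative amount, at
    most [B ^ (l - r)] times the full moment of order [2 * r]. *)
Lemma I_count_approx l r (B : nat) : (r <= l)%N ->
  (forall j, j != j0 -> `|S j| ^+ 2 <= B%:R) ->
  (N ^ (2 * l) <= p.-1 * I_count l p H N <=
   N ^ (2 * l) + B ^ (l - r) * (p.-1 * I_count r p H N))%N.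
Proof.
move=> le_rl hB.
have E : (p.-1 * I_count l p H N)%:R =
    (N ^ (2 * l))%:R + \sum_(j | j != j0) `|S j| ^+ (2 * l) :> algC.
  by rewrite natrM -moment_I_count /moment (bigD1 j0) //= facsum_trivial normr_nat natrX.
have pos : 0 <= \sum_(j | j != j0) `|S j| ^+ (2 * l).
  by apply: sumr_ge0 => j _; apply: exprn_ge0.
rewrite -!(ler_nat algC) E lerDl pos /= natrD lerD2l.
rewrite !natrM -moment_I_count /moment mulr_sumr.
apply: le_trans (_ : \sum_(j | j != j0) (B ^ (l - r))%:R * `|S j| ^+ (2 * r) <= _).
  apply: ler_sum => j jj0; rewrite -{1}(subnK le_rl) mulnDr exprD ler_wpM2r ?exprn_ge0 //.
  by rewrite exprM natrX; apply: lerXn2r; rewrite ?nnegrE ?exprn_ge0 ?ler0n ?hB.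
by rewrite [leRHS](bigD1 j0) //= lerDr mulr_ge0 ?ler0n ?exprn_ge0.
Qed.

Lemma I_count0 : I_count 0 p H N = 1%N.
Proof.
apply/eqP; rewrite -(eqr_nat algC) -(inj_eq (mulfI (_ : p.-1%:R != 0 :> algC))).
  rewrite -moment_I_count /moment (eq_bigr (fun=> 1)) => [|j _]; last by rewrite expr0.
  by rewrite sumr_const card_ord mulr1.
by rewrite pnatr_eq0 -lt0n.
Qed.

End Moments.

(** The characters are eliminated from the statement: [B] is admissible through the trivial bound or
    through [facsum_bound] for some [K] and [q]. *)
Lemma I_count_near_mean p H N l r (B : nat) : prime p -> (2 < p)%N -> (0 < N)%N -> (H + N < p)%N ->
  (r <= l)%N ->
  (N ^ 2 <= B)%N \/ (exists K q, [/\ (0 < K <= p)%N, (0 < q)%N, (p <= q ^ 2)%N &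
     (2 * K ^ 3 + 4 * N ^ 2 + 4 * K ^ 2 * N * q <= K * B)%N]) ->
  (N ^ (2 * l) <= p.-1 * I_count l p H N <=
   N ^ (2 * l) + B ^ (l - r) * (p.-1 * I_count r p H N))%N.
Proof.
move=> p_pr p_gt2 N_gt0 HNp le_rl hB.
have [chi [j0 mc]] := mult_chars_exist p_pr; have [psi ac] := add_chars_exist p_pr.
apply: (I_count_approx p_pr mc) => // j jj0; case: hB => [hB|[K [q [hK hq hpq hX]]]].
  by apply: le_trans (facsum_le mc H N j) _; rewrite ler_nat.
have K_gt0 : 0 < K%:R :> algC by rewrite ltr0n; case/andP: hK.
rewrite -(ler_pM2l K_gt0); apply: le_trans (facsum_bound p_pr p_gt2 mc ac N_gt0 HNp jj0 hK hq hpq) _.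
by rewrite -natrM ler_nat.
Qed.

Lemma I_count_step p H N l K : prime p -> (H + N < p)%N -> (0 < K)%N ->
  (I_count l.+1 p H N <= (N %/ K).+1 * (N * I_count l p H N + 2 * K ^ 2 * N ^ (2 * l)))%N.
Proof.
by move=> p_pr HNp K_gt0; have [chi [j0 mc]] := mult_chars_exist p_pr; apply: (I_count_rec p_pr mc).
Qed.

(** * The asymptotic formula *)

Lemma I_count_zero p H N : prime p -> (H + N < p)%N -> I_count 0 p H N = 1%N.
Proof.
by move=> p_pr HNp; have [chi [j0 mc]] := mult_chars_exist p_pr; apply: (I_count0 p_pr mc).
Qed.

Lemma truncn_half (R : realType) (y : R) : 1 <= y ->
  [/\ (0 < Num.truncn y)%N, (Num.truncn y)%:R <= y & y <= 2 * (Num.truncn y)%:R].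
Proof.
move=> y1; have /truncn_itv/andP[h1 h2] : 0 <= y by lra.
have K_gt0 : (0 < Num.truncn y)%N by rewrite truncn_gt0.
split=> //; apply: (le_trans (ltW h2)); rewrite -natr1.
have : 1 <= (Num.truncn y)%:R :> R by rewrite ler1n.
lra.
Qed.

Lemma I_count_bound (R : realType) r : exists C : R, 0 < C /\
  forall p H N : nat, prime p -> (0 < N)%N -> (H + N < p)%N ->
  (I_count r p H N)%:R <= C * N%:R `^ (2 * r%:R - 1 + 2 ^- r).
Proof.
elim: r => [|r [C [C_gt0 IH]]].
  exists 1; split=> // p H N p_pr _ HNp; rewrite I_count_zero //.
  by rewrite mulr0 expr0 invr1 add0r addNr powRr0 mulr1.
exists (4 * (C + 2)); split; first by rewrite mulr_gt0 ?addr_gt0.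
move=> p H N p_pr N_gt0 HNp.
have x_ge1 : 1 <= N%:R :> R by rewrite ler1n.
have x_gt0 : 0 < N%:R :> R by rewrite ltr0n.
set x : R := N%:R in x_ge1 x_gt0 *.
(* The block length that balances the two terms of [I_count_step], as [E1] confirms. Rounding [y]
   down to [K] costs at most a factor 2. *)
pose y := x `^ (2 ^- r.+1).
have d_ge0 : 0 <= 2 ^- r.+1 :> R by rewrite invr_ge0 exprn_ge0.
have d_le1 : 2 ^- r.+1 <= 1 :> R by rewrite invf_le1 ?exprn_gt0 // exprn_ege1 // ler1n.
have y_ge1 : 1 <= y by rewrite -(powRr0 x) ler_powR.
have y_lex : y <= x by rewrite -[leRHS]powRr1 ?ler_powR // ltW.
have y_gt0 : 0 < y by lra.
have [K_gt0 K_ley y_le2K] := truncn_half y_ge1.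
set K := Num.truncn y in K_gt0 K_ley y_le2K.
have Kr_gt0 : 0 < K%:R :> R by rewrite ltr0n.
have B_le : (N %/ K).+1%:R <= 4 * x / y.
  have h : (N %/ K)%:R <= x / K%:R by rewrite ler_pdivlMr // -natrM ler_nat leq_trunc_div.
  have h1 : 1 <= x / K%:R by rewrite ler_pdivlMr // mul1r; lra.
  have h2 : x / K%:R <= 2 * x / y.
    rewrite ler_pdivrMr // mulrAC ler_pdivlMr // [2 * x]mulrC -mulrA ler_pM2l //.
  by rewrite -natr1; lra.
have := I_count_step r p_pr HNp K_gt0; rewrite -(ler_nat R) natrM => /le_trans; apply.
apply: le_trans (_ : 4 * x / y * (x * (C * x `^ (2 * r%:R - 1 + 2 ^- r)) + 2 * y ^+ 2 * x ^+ (2 * r)) <= _).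
  have -> : (N * I_count r p H N + 2 * K ^ 2 * N ^ (2 * r))%:R =
      x * (I_count r p H N)%:R + 2 * K%:R ^+ 2 * x ^+ (2 * r).
    by rewrite -!natrX -!natrM -natrD.
  rewrite ler_pM ?addr_ge0 ?mulr_ge0 ?exprn_ge0 ?ler0n // lerD //.
    by rewrite ler_pM2l // IH.
  rewrite ler_pM2r ?exprn_gt0 // ler_pM2l // ler_pXn2r ?nnegrE // ?ler0n //; lra.
have E1 : x * x `^ (2 * r%:R - 1 + 2 ^- r) = y ^+ 2 * x ^+ (2 * r).
  rewrite -[X in X * _](powRr1 (ltW x_gt0)) -powRD; last by rewrite gt_eqF ?implybT.
  rewrite -(powR_mulrn (2 * r)) ?ltW // -(powR_mulrn 2) ?powR_ge0 // /y -powRrM.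
  rewrite -powRD; last by rewrite gt_eqF ?implybT.
  congr (_ `^ _); rewrite natrM exprS invfM; field.
  by rewrite expf_neq0.
have E2 : x `^ (2 * r.+1%:R - 1 + 2 ^- r.+1) = y * x * x ^+ (2 * r).
  rewrite -[X in _ * X * _](powRr1 (ltW x_gt0)) -(powR_mulrn (2 * r)) ?ltW //.
  rewrite /y -!powRD; try by rewrite gt_eqF ?implybT.
  by congr (_ `^ _); rewrite natrM -natr1; ring.
rewrite E2 [x * (C * _)]mulrCA E1 le_eqVlt; apply/orP; left; apply/eqP; field.
by rewrite gt_eqF.
Qed.

(** If [N] is below the square root of p, the trivial bound suffices. Otherwise the block length is
    about [v / u], which balances [N ^ 2 / K] against [K * N * q]. *)
Lemma facsum_sq_constant (R : realType) p N : (2 < p)%N -> (0 < N)%N -> (N < p)%N ->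
  exists B : nat, [/\ B%:R <= 19 * (N%:R `^ 2^-1 ^+ 3 * p%:R `^ 4^-1) :> R &
  (N ^ 2 <= B)%N \/ (exists K q, [/\ (0 < K <= p)%N, (0 < q)%N, (p <= q ^ 2)%N &
     (2 * K ^ 3 + 4 * N ^ 2 + 4 * K ^ 2 * N * q <= K * B)%N])].
Proof.
move=> p_gt2 N_gt0 lt_Np.
have x_ge1 : 1 <= N%:R :> R by rewrite ler1n.
have p_ge1 : 1 <= p%:R :> R by rewrite ler1n; lia.
set v : R := N%:R `^ 2^-1; set u : R := p%:R `^ 4^-1.
have v2 : v ^+ 2 = N%:R.
  by rewrite -powR_mulrn ?powR_ge0 // -powRrM mulVf ?powRr1 //; lra.
have u4 : u ^+ 4 = p%:R.
  by rewrite -powR_mulrn ?powR_ge0 // -powRrM mulVf ?powRr1 //; lra.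
have v_ge1 : 1 <= v by rewrite -(powRr0 N%:R) ler_powR // invr_ge0.
have u_ge1 : 1 <= u by rewrite -(powRr0 p%:R) ler_powR // invr_ge0.
have [lt_vu|le_uv] := ltP v u.
  exists (N ^ 2)%N; split; last by left.
  rewrite natrX -v2; nra.
pose y := v / u; have y_ge1 : 1 <= y by rewrite ler_pdivlMr ?mul1r //; lra.
have vE : v = y * u by rewrite divfK //; lra.
have [K_gt0 K_ley y_le2K] := truncn_half y_ge1.
set K := Num.truncn y in K_gt0 K_ley y_le2K.
have u2_ge1 : 1 <= u ^+ 2 by rewrite exprn_ege1.
have [s_gt0 s_le _] := truncn_half u2_ge1.
have /truncn_itv/andP[_ lt_sq] : 0 <= u ^+ 2 by lra.
set q := (Num.truncn (u ^+ 2)).+1 in lt_sq.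
have q_le : q%:R <= 2 * u ^+ 2 by rewrite /q -natr1; lra.
pose X := (2 * K ^ 3 + 4 * N ^ 2 + 4 * K ^ 2 * N * q)%N.
exists (X %/ K).+1; split; last first.
  right; exists K, q; split => //.
  - rewrite K_gt0 /= ltnW // -(ltr_nat R); apply: le_lt_trans (_ : N%:R < _); last by rewrite ltr_nat.
    rewrite -v2; apply: le_trans K_ley _; rewrite vE; nra.
  - rewrite -(ler_nat R) natrX -u4 (_ : 4 = 2 * 2)%N // exprM ler_pXn2r ?nnegrE ?ler0n //; lra.
  by rewrite [leqRHS]mulnC; apply/ltnW/ltn_ceil.
have Kr_ge1 : 1 <= K%:R :> R by rewrite ler1n.
have Kr_gt0 : 0 < K%:R :> R by rewrite ltr0n.
have h : (X %/ K)%:R <= X%:R / K%:R :> R by rewrite ler_pdivlMr // -natrM ler_nat leq_trunc_div.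
apply: le_trans (_ : X%:R / K%:R + 1 <= _); first by rewrite -natr1 lerD2r.
have -> : X%:R / K%:R = 2 * K%:R ^+ 2 + 4 * N%:R ^+ 2 / K%:R + 4 * K%:R * N%:R * q%:R :> R.
  have -> : X%:R = 2 * K%:R ^+ 3 + 4 * N%:R ^+ 2 + 4 * K%:R ^+ 2 * N%:R * q%:R :> R.
    by rewrite -!natrX -!natrM -!natrD.
  by field; rewrite gt_eqF.
have T1 : 1 <= v ^+ 3 * u by rewrite mulr_ege1 // exprn_ege1.
have TE : v ^+ 3 * u = y ^+ 3 * u ^+ 4 by rewrite vE; ring.
have y_ge0 : 0 <= y by lra.
have t1 : K%:R ^+ 2 <= v ^+ 3 * u :> R.
  apply: le_trans (_ : y ^+ 2 <= _); first by rewrite lerXn2r ?nnegrE.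
  rewrite TE [y ^+ 3]exprSr -mulrA ler_peMr ?exprn_ge0 // mulr_ege1 //.
  by rewrite exprn_ege1.
have t2 : N%:R ^+ 2 / K%:R <= 2 * (v ^+ 3 * u) :> R.
  have N2E : N%:R ^+ 2 = y ^+ 3 * u ^+ 4 * y by rewrite -v2 vE; ring.
  rewrite ler_pdivrMr // N2E TE (_ : 2 * _ * _ = y ^+ 3 * u ^+ 4 * (2 * K%:R)); last by ring.
  rewrite ler_wpM2l // mulr_ge0 ?exprn_ge0 //; lra.
have t3 : K%:R * N%:R * q%:R <= 2 * (v ^+ 3 * u) :> R.
  rewrite TE (_ : 2 * _ = y * (v ^+ 2) * (2 * u ^+ 2)); last by rewrite vE; ring.
  by rewrite v2 ler_pM ?mulr_ge0 ?ler0n // ler_wpM2r ?ler0n.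
(* The constant is 19 = 2 + 8 + 8 + 1, the last unit coming from rounding [B] up. *)
rewrite -![4 * _ * _]mulrA; lra.
Qed.

Theorem theorem7 (R : realType) (l r : nat) (hr : (1 <= r)%N) (hrl : (r <= l)%N) :
  exists C : R, 0 < C /\
    forall p H N : nat, prime p -> odd p -> (H < H + N)%N -> (H + N < p)%N ->
      `| (I_count l p H N)%:R - N%:R ^+ (2 * l) / (p%:R - 1) | <=
      C * (N%:R `^ (3 * l%:R / 2 + r%:R / 2 - 1 + 2 ^- r)
           * p%:R `^ ((l%:R - r%:R) / 4)
           * ln p%:R `^ ((l%:R - r%:R) / 2)).
Proof.
have [Cr [Cr_gt0 hCr]] := I_count_bound R r.
(* The estimates obtained contain no logarithm. Since p is at least 3, the logarithmic factor is at
   least [c], and dividing the constant by [c] brings it in. *)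
have c_gt0 : 0 < ln 3 `^ ((l%:R - r%:R) / 2) :> R by rewrite powR_gt0 // ln_gt0 // ltr1n.
set c := ln 3 `^ _ in c_gt0.
exists (19 ^+ (l - r) * Cr / c); split; first by rewrite divr_gt0 // mulr_gt0 // exprn_gt0.
move=> p H N p_pr p_odd; rewrite -{1}[H]addn0 ltn_add2l => N_gt0 HNp.
have p_gt2 : (2 < p)%N.
  by have := prime_gt1 p_pr; case: (ltngtP 2 p) p_odd => // <-.
have lt_Np : (N < p)%N by lia.
have [B [B_le hB]] := facsum_sq_constant R p_gt2 N_gt0 lt_Np.
have /andP[low up] := I_count_near_mean p_pr p_gt2 N_gt0 HNp hrl hB.
have p1E : p%:R - 1 = p.-1%:R :> R.
  by rewrite -(prednK (prime_gt0 p_pr)) -natr1 addrK.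
have p1_gt0 : 0 < p.-1%:R :> R by rewrite ltr0n; lia.
have le1 : `|(I_count l p H N)%:R - N%:R ^+ (2 * l) / (p%:R - 1)| <=
    (B ^ (l - r) * I_count r p H N)%:R :> R.
  rewrite p1E ger0_norm; last first.
    by rewrite subr_ge0 ler_pdivrMr // -natrX -natrM ler_nat [leqRHS]mulnC.
  rewrite lerBlDr -(ler_pM2l p1_gt0) mulrDr mulrCA divff ?gt_eqF // mulr1.
  by rewrite -natrX -!natrM -natrD ler_nat addnC mulnCA.
apply: le_trans le1 _; rewrite natrM natrX.
set v := N%:R `^ 2^-1 in B_le; set u := p%:R `^ 4^-1 in B_le.
apply: le_trans (_ : (19 * (v ^+ 3 * u)) ^+ (l - r) * (Cr * N%:R `^ (2 * r%:R - 1 + 2 ^- r)) <= _).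
  by apply: ler_pM; rewrite ?exprn_ge0 ?ler0n ?hCr //; apply: lerXn2r; rewrite ?nnegrE ?(le_trans _ B_le) ?ler0n.
have x_gt0 : 0 < N%:R :> R by rewrite ltr0n.
have pr_gt0 : 0 < p%:R :> R by rewrite ltr0n prime_gt0.
have mE : (l - r)%:R = l%:R - r%:R :> R by rewrite natrB.
have E1 : N%:R `^ (3 * l%:R / 2 + r%:R / 2 - 1 + 2 ^- r) =
    (v ^+ 3) ^+ (l - r) * N%:R `^ (2 * r%:R - 1 + 2 ^- r).
  rewrite -exprM -(powR_mulrn (3 * (l - r))) ?powR_ge0 // /v -powRrM -powRD; last first.
    by apply/implyP => _; rewrite gt_eqF.
  by congr (_ `^ _); rewrite natrM mE; field; rewrite expf_neq0.
have E2 : p%:R `^ ((l%:R - r%:R) / 4) = u ^+ (l - r).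
  by rewrite -(powR_mulrn (l - r)) ?powR_ge0 // /u -powRrM mE mulrC.
have ln_ge : c <= ln p%:R `^ ((l%:R - r%:R) / 2).
  rewrite /c ge0_ler_powR ?nnegrE ?ln_ge0 ?ler1n //.
  - by rewrite divr_ge0 // -mE ler0n.
  - by lia.
  by rewrite ler_ln ?posrE ?ltr0n // ?ler_nat //; lia.
rewrite E1 E2; set P := N%:R `^ _; set L := ln _ `^ _ in ln_ge *.
rewrite [leLHS](_ : _ =
  (19 ^+ (l - r) * Cr / c * ((v ^+ 3) ^+ (l - r) * P * u ^+ (l - r))) * c); last first.
  by rewrite !exprMn; field; rewrite gt_eqF.
rewrite [leRHS]mulrA ler_wpM2l //.
by rewrite !mulr_ge0 ?exprn_ge0 ?powR_ge0 ?invr_ge0 // ltW.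
Qed.
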